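(* Let $\mathcal{G}$ be a totally disconnected étale groupoid, let $\mathcal{G}'\subset\mathcal{G}$ be an open subgroupoid with $\mathcal{G}'^{(0)}=\mathcal{G}^{(0)}$, put $\Delta:=\mathcal{G}\setminus\mathcal{G}'$, $\mathcal{H}:=\mathcal{G}|r(\Delta)$ and $\mathcal{H}':=\mathcal{G}'|r(\Delta)$, where $\mathcal{H}$ and $\mathcal{H}'$ carry the topologies described in the context. Suppose that the inclusion $\mathcal{G}'\subset\mathcal{G}$ is regular. Let $A$ be a discrete abelian group. Then there is a diagram consisting of two long exact sequences $$\cdots\to H_n(\mathcal{G}',A)\to H_n(\mathcal{G},A)\to H_n(\mathcal{G}/\mathcal{G}',A)\to H_{n-1}(\mathcal{G}',A)\to\cdots$$ $$\cdots\to H_n(\mathcal{H}',A)\to H_n(\mathcal{H},A)\to H_n(\mathcal{H}/\mathcal{H}',A)\to H_{n-1}(\mathcal{H}',A)\to\cdots$$ (the maps being induced by the inclusions of chain complexes, the quotient maps and the connecting homomorphisms) together with an identification $H_n(\mathcal{G}/\mathcal{G}',A)=H_n(\mathcal{H}/\mathcal{H}',A)$ for every $n\ge 0$, induced by the isomorphism of quotient complexes $\mathcal{C}(\mathcal{G},A)/\mathcal{C}(\mathcal{G}',A)\cong\mathcal{C}(\mathcal{H},A)/\mathcal{C}(\mathcal{H}',A)$ which in degree $n$ matches the class of $f\in C_c(\mathcal{G}^{(n)},A)$ with the class of $h\in C_c(\mathcal{H}^{(n)},A)$ exactly when $f$ and $h$ agree on the set $\mathcal{G}^{(n)}\setmi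nus\mathcal{G}'^{(n)}=\mathcal{H}^{(n)}\setminus\mathcal{H}'^{(n)}$.
   Context: An étale groupoid means a second countable locally compact Hausdorff topological groupoid whose range map is a local homeomorphism. $\mathcal{G}^{(0)}$ is the unit space, $s(g)=g^{-1}g$, $r(g)=gg^{-1}$. For $Y\subset\mathcal{G}^{(0)}$, $\mathcal{G}|Y:=r^{-1}(Y)\cap s^{-1}(Y)$. A space is totally disconnected if its connected components are singletons. For $n\ge1$, $\mathcal{G}^{(n)}$ is the space of $(g_1,\dots,g_n)\in\mathcal{G}^n$ with $s(g_i)=r(g_{i+1})$ for $1\le i\le n-1$ (relative topology from the product). Homology. $C_c(X,A)$ is the abelian group of continuous compactly supported functions $X\to A$. For a local homeomorphism $\pi:X\to Y$, $\pi_*:C_c(X,A)\to C_c(Y,A)$ is $\pi_*(f)(y)=\sum_{\pi(x)=y}f(x)$. For $n\geq2$ and $0\le i\le n$ let $d_i:\mathcal{G}^{(n)}\to\mathcal{G}^{(n-1)}$ be $d_0(g_1,\dots,g_n)=(g_2,\dots,g_n)$, $d_i(g_1,\dots,g_n)=(g_1,\dots,g_ig_{i+1},\dots,g_n)$ for $1\le i\le n-1$, $d_n(g_1,\dots,g_n)=(g_1,\dots,g_{n-1})$; for $n=1$, $d_0=s$, $d_1=r$. Put $\partial_n=\sum_{i=0}^n(-1)^id_{i*}$. The chain complex $\mathcal{C}(\mathcal{G},A)=(C_c(\mathcal{G}^{(n)},A),\partial_n)_{n\ge0}$ has homology $H_n(\mathcal{G},A)$. If $\mathcal{G}'\subset\mathcal{G}$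 is an open subgroupoid, extension by zero makes $\mathcal{C}(\mathcal{G}',A)$ a subcomplex of $\mathcal{C}(\mathcal{G},A)$, and $H_*(\mathcal{G}/\mathcal{G}',A)$ denotes the homology of the quotient complex $\mathcal{C}(\mathcal{G},A)/\mathcal{C}(\mathcal{G}',A)$; likewise for $\mathcal{H}'\subset\mathcal{H}$. Regularity. The inclusion $\mathcal{G}'\subset\mathcal{G}$ is regular if $r:\Delta\to r(\Delta)$ is open when $r(\Delta)$ carries the quotient topology from this map ($\Delta$ has the relative topology from $\mathcal{G}$); equivalently, for every open $U\subset\Delta$ the set $r^{-1}(r(U))\cap\Delta$ is open in $\Delta$. Topologies on $\mathcal{H},\mathcal{H}'$. $\mathcal{H}'$ is a subgroupoid of $\mathcal{H}$, $\mathcal{H}=\mathcal{H}'\sqcup\Delta$, $\mathcal{H}^{(0)}=\mathcal{H}'^{(0)}=r(\Delta)$. Let $m:\mathcal{G}^{(2)}\to\mathcal{G}$ be multiplication. The map $m:(\Delta\times\Delta)\cap m^{-1}(\mathcal{G}')\to\mathcal{H}'$ (defined on composable pairs in $\Delta\times\Delta$ with product in $\mathcal{G}'$) is surjective; $\mathcal{H}'$ is given the quotient topology from it, and $\mathcal{H}=\mathcal{H}'\sqcup\Delta$ the disjoint union topology, $\Delta$ having the relative topology from $\mathcal{G}$. When the inclusion $\mathcal{G}'\subset\mathcal{G}$ is regular, $\mathcal{H}$ and $\mathcal{H}'$ are étale groupoids and $\mathcal{H}'$ is clopen in $\mathcal{H}$. *)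

(* Defs.v *)
From HB Require Import structures.
From mathcomp Require Import all_boot all_order all_algebra.
From mathcomp Require Import all_classical all_reals topology.

Set Implicit Arguments.
Unset Strict Implicit.
Unset Printing Implicit Defensive.

Import GRing.Theory.

Local Open Scope classical_set_scope.
Local Open Scope ring_scope.

Section quotient_map.
Variables (U V : zmodType) (I : zmodClosed U) (J : zmodClosed V).
Variables (f : {additive U -> V}) (fIJ : forall x, x \in I -> f x \in J).

Definition quot_fun (x : Quotient.quot I) : Quotient.quot J :=
  \pi_(Quotient.quot J)%qT (f (repr x)).

Lemma quot_funE x :
  quot_fun (\pi_(Quotient.quot I)%qT x) = \pi_(Quotient.quot J)%qT (f x).
Proof.
apply/eqP; rewrite /quot_fun -Quotient.idealrBE -raddfB fIJ //.
by rewrite Quotient.idealrBE reprK.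
Qed.

Lemma quot_fun_is_zmod_morphism : zmod_morphism quot_fun.
Proof.
move=> x y; rewrite -[x]reprK -[y]reprK -raddfB !quot_funE raddfB.
exact: raddfB.
Qed.

#[local] HB.instance Definition _ :=
  GRing.isZmodMorphism.Build (Quotient.quot I) (Quotient.quot J) quot_fun
    quot_fun_is_zmod_morphism.

Definition quot_map : {additive Quotient.quot I -> Quotient.quot J} := quot_fun.

End quotient_map.

(* Chain complexes of abelian groups, indexed by nat: cdiff n is the map from  *)
(* degree n.+1 to degree n, and there is nothing below degree 0.               *)
Record complex := Complex {
  cobj :> nat -> zmodType;
  cdiff : forall n, {additive cobj n.+1 -> cobj n};
  cdiffK : forall n (c : cobj n.+2), cdiff n (cdiff n.+1 c) = 0
}.

Section homology.
Variable C : complex.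

Definition is_cycle n : {pred C n} :=
  match n return {pred C n} with
  | 0 => predT
  | m.+1 => fun c => cdiff C m c == 0
  end.

Lemma cycle_zmod_closed n : zmod_closed (@is_cycle n).
Proof.
case: n => [|n]; split => // [|x y]; rewrite /in_mem /= ?raddf0 //.
by move=> /eqP x0 /eqP y0; rewrite raddfB /= x0 y0 subr0.
Qed.

HB.instance Definition _ n :=
  GRing.isZmodClosed.Build (C n) (@is_cycle n) (cycle_zmod_closed n).

Record cycles n := Cycles { cycles_val :> C n; _ : cycles_val \in @is_cycle n }.
HB.instance Definition _ n := [isSub for @cycles_val n].
HB.instance Definition _ n := [Choice of cycles n by <:].
HB.instance Definition _ n :=
  [SubChoice_isSubZmodule of cycles n by <:].

Definition is_boundary n : {pred cycles n} :=
  fun z => `[< exists c : C n.+1, cdiff C n c = val z >].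

Lemma boundary_zmod_closed n : zmod_closed (@is_boundary n).
Proof.
split; first by apply/asboolP; exists 0; rewrite !raddf0.
move=> x y /asboolP[c cx] /asboolP[d dy]; apply/asboolP; exists (c - d).
by rewrite raddfB /= cx dy.
Qed.

HB.instance Definition _ n :=
  GRing.isZmodClosed.Build (cycles n) (@is_boundary n) (boundary_zmod_closed n).

Definition homology n : zmodType := Quotient.quot (@is_boundary n).

Definition hclass n (z : cycles n) : homology n := \pi_(Quotient.quot (@is_boundary n))%qT z.

End homology.

Record chain_map (C D : complex) := ChainMap {
  chain_fun :> forall n, {additive C n -> D n};
  chain_funE : forall n (c : C n.+1),
    chain_fun n (cdiff C n c) = cdiff D n (chain_fun n.+1 c)
}.

Section homology_map.
Variables (C D : complex) (phi : chain_map C D).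

Lemma chain_map_cycle n (z : cycles C n) : phi n (val z) \in @is_cycle D n.
Proof.
case: n z => [//|n] z; have /eqP zE := valP z.
by apply/eqP; rewrite -chain_funE zE raddf0.
Qed.

Definition cycles_map n (z : cycles C n) : cycles D n :=
  Cycles (chain_map_cycle z).

Lemma cycles_map_is_zmod_morphism n : zmod_morphism (@cycles_map n).
Proof. by move=> x y; apply: val_inj; rewrite /= !raddfB. Qed.

HB.instance Definition _ n :=
  GRing.isZmodMorphism.Build (cycles C n) (cycles D n) (@cycles_map n)
    (@cycles_map_is_zmod_morphism n).

Lemma cycles_map_boundary n (z : cycles C n) :
  z \in @is_boundary C n -> cycles_map z \in @is_boundary D n.
Proof.
move=> /asboolP[c cz]; apply/asboolP; exists (phi n.+1 c).
by rewrite -chain_funE cz.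
Qed.

Definition homology_map n : {additive homology C n -> homology D n} :=
  quot_map (@cycles_map_boundary n).

Lemma homology_mapE n (z : cycles C n) :
  homology_map n (hclass z) = hclass (cycles_map z).
Proof. exact: quot_funE (@cycles_map_boundary n) z. Qed.

End homology_map.

Section quotient_complex.
Variables (C D : complex) (phi : chain_map C D).

Definition chain_image n : {pred D n} := fun d => `[< exists c, phi n c = d >].

Lemma chain_image_zmod_closed n : zmod_closed (@chain_image n).
Proof.
split; first by apply/asboolP; exists 0; rewrite raddf0.
move=> x y /asboolP[c cx] /asboolP[d dy]; apply/asboolP; exists (c - d).
by rewrite raddfB cx dy.
Qed.

HB.instance Definition _ n :=
  GRing.isZmodClosed.Build (D n) (@chain_image n) (chain_image_zmod_closed n).

Lemma cdiff_chain_image n (d : D n.+1) :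
  d \in @chain_image n.+1 -> cdiff D n d \in @chain_image n.
Proof.
move=> /asboolP[c cd]; apply/asboolP; exists (cdiff C n c).
by rewrite chain_funE cd.
Qed.

Definition quot_cobj n : zmodType := Quotient.quot (@chain_image n).

Definition quot_cdiff n : {additive quot_cobj n.+1 -> quot_cobj n} :=
  quot_map (@cdiff_chain_image n).

Lemma quot_cdiffE n (d : D n.+1) :
  quot_cdiff n (\pi_(Quotient.quot (@chain_image n.+1))%qT d) =
  \pi_(Quotient.quot (@chain_image n))%qT (cdiff D n d).
Proof. exact: quot_funE (@cdiff_chain_image n) d. Qed.

Lemma quot_cdiffK n (c : quot_cobj n.+2) : quot_cdiff n (quot_cdiff n.+1 c) = 0.
Proof. by rewrite -[c]reprK !quot_cdiffE cdiffK raddf0. Qed.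

Definition quot_complex : complex := Complex quot_cdiffK.

Definition quot_proj_fun n : {additive D n -> quot_complex n} :=
  \pi_(Quotient.quot (@chain_image n))%qT.

Lemma quot_proj_funE n (d : D n.+1) :
  quot_proj_fun n (cdiff D n d) = cdiff quot_complex n (quot_proj_fun n.+1 d).
Proof. exact: esym (quot_cdiffE d). Qed.

Definition quot_proj : chain_map D quot_complex := ChainMap quot_proj_funE.

End quotient_complex.

Definition exact_at (U V W : zmodType) (f : U -> V) (g : V -> W) : Prop :=
  range f = g @^-1` [set 0].

(* For an injective i this determines delta: it is the connecting map of the   *)
(* short exact sequence 0 -> C -> D -> D/C -> 0.                               *)
Definition is_connecting (C D : complex) (i : chain_map C D) n
    (delta : homology (quot_complex i) n.+1 -> homology C n) : Prop :=
  forall (z : cycles (quot_complex i) n.+1) (d : D n.+1) (w : cycles C n),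
    quot_proj i n.+1 d = val z -> cdiff D n d = i n (val w) ->
    delta (hclass z) = hclass w.

Definition long_exact_sequence (C D : complex) (i : chain_map C D) : Prop :=
  exists delta :
      forall n, {additive homology (quot_complex i) n.+1 -> homology C n},
    [/\ forall n, is_connecting (delta n),
        forall n, exact_at (homology_map i n) (homology_map (quot_proj i) n),
        forall n, exact_at (homology_map (quot_proj i) n.+1) (delta n),
        forall n, exact_at (delta n) (homology_map i n) &
        range (homology_map (quot_proj i) 0) = setT].

Section compactly_supported.
Variables (X : topologicalType) (A : zmodType).

Definition compactly_supported : {pred X -> A} := fun f =>
  `[< continuous (f : X -> discrete_topology A) /\
      compact (closure [set x | f x != 0]) >].

Lemma compactly_supported_zmod_closed : zmod_closed compactly_supported.
Proof.
split.
  apply/asboolP; split; first by move=> x; exact: cst_continuous.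
  rewrite (_ : [set x | _] = set0) ?closure0; first exact: compact0.
  by apply/seteqP; split => // x /=; rewrite eqxx.
move=> f g /asboolP[fc fK] /asboolP[gc gK]; apply/asboolP; split.
  have loc (h : X -> discrete_topology A) :
      continuous h -> forall x, \forall y \near x, h y = h x.
    by move=> hc x; exact: hc (discrete_set1 (h x)).
  move=> x U /nbhs_singleton Ux; have fx := loc _ fc x; have gx := loc _ gc x.
  change (\forall y \near x, U (f y - g y)).
  by apply: filterS2 fx gx => y -> ->.
apply: (@subclosed_compact _ _
  (closure [set x | f x != 0] `|` closure [set x | g x != 0])).
- exact: closed_closure.
- exact: compactU.
- rewrite -closureU; apply: closure_subset => x /=; apply: contraPP.
  by move=> /not_orP[/negP/negPn/eqP fx0 /negP/negPn/eqP gx0];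
    rewrite !fctE fx0 gx0 subrr eqxx.
Qed.

HB.instance Definition _ :=
  GRing.isZmodClosed.Build (X -> A) compactly_supported
    compactly_supported_zmod_closed.

Record Cc := MkCc { Cc_fun :> X -> A; _ : Cc_fun \in compactly_supported }.
HB.instance Definition _ := [isSub for Cc_fun].
HB.instance Definition _ := [Choice of Cc by <:].
HB.instance Definition _ := [SubChoice_isSubZmodule of Cc by <:].

End compactly_supported.

Definition pushforward (X Y : choiceType) (A : zmodType) (p : X -> Y)
    (f : X -> A) : Y -> A :=
  fun y => \sum_(x \in p @^-1` [set y]) f x.

Definition local_homeomorphism (X Y : topologicalType) (p : X -> Y) : Prop :=
  forall x, exists U : set X,
    [/\ open U /\ U x, set_inj U p, {within U, continuous p} &
        forall V, open V -> V `<=` U -> open (p @` V)].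

(* A groupoid given by its set of arrows. The product is a total function that *)
(* is only meaningful on composable pairs, i.e. when s(g) = r(h); nothing is   *)
(* required of it elsewhere.                                                   *)
Section groupoid_laws.
Variables (T : Type) (mul : T -> T -> T) (inv : T -> T).
Local Notation src g := (mul (inv g) g).
Local Notation rng g := (mul g (inv g)).

Record groupoid_laws : Prop := GroupoidLaws {
  src_inv : forall g, src (inv g) = rng g;
  rng_inv : forall g, rng (inv g) = src g;
  src_mul : forall g h, src g = rng h -> src (mul g h) = src h;
  rng_mul : forall g h, src g = rng h -> rng (mul g h) = rng g;
  gmulA : forall g h k, src g = rng h -> src h = rng k ->
    mul g (mul h k) = mul (mul g h) k;
  gmul_src : forall g, mul g (src g) = g;
  gmul_rng : forall g, mul (rng g) g = g
}.
End groupoid_laws.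

(* No compatibility between the topology and the operations is built in here;  *)
(* see topological_groupoid below.                                             *)
Record groupoid := Groupoid {
  arrows :> topologicalType;
  gmul : arrows -> arrows -> arrows;
  ginv : arrows -> arrows;
  gP : groupoid_laws gmul ginv
}.

Section groupoid_defs.
Variable G : groupoid.
Implicit Types g h : G.

Definition gsrc g : G := gmul (ginv g) g.
Definition grng g : G := gmul g (ginv g).
Definition units : set G := range gsrc.
Definition composable : set (G * G) := [set p | gsrc p.1 = grng p.2].

Lemma gsrcM g h : composable (g, h) -> gsrc (gmul g h) = gsrc h.
Proof. exact: (src_mul (gP G) (g := g) (h := h)). Qed.

Lemma grngM g h : composable (g, h) -> grng (gmul g h) = grng g.
Proof. exact: (rng_mul (gP G) (g := g) (h := h)). Qed.

Lemma gassoc g h k : composable (g, h) -> composable (h, k) ->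
  gmul g (gmul h k) = gmul (gmul g h) k.
Proof. exact: (gmulA (gP G) (g := g) (h := h) (k := k)). Qed.

Lemma composable_inv_l g : composable (ginv g, g).
Proof. exact: src_inv (gP G) g. Qed.

Lemma composable_inv_r g : composable (g, ginv g).
Proof. exact: esym (rng_inv (gP G) g). Qed.

Lemma composable_src g : composable (g, gsrc g).
Proof.
rewrite /composable /= [RHS](grngM (composable_inv_l g)).
exact: composable_inv_r.
Qed.

Lemma composable_rng g : composable (grng g, g).
Proof.
rewrite /composable /= [LHS](gsrcM (composable_inv_r g)).
exact: composable_inv_l.
Qed.

Lemma composable_mul_l g h k :
  composable (g, h) -> composable (h, k) -> composable (gmul g h, k).
Proof. by move=> gh hk; rewrite /composable /= [LHS](gsrcM gh). Qed.

Lemma composable_mul_r g h k :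
  composable (g, h) -> composable (h, k) -> composable (g, gmul h k).
Proof. by move=> gh hk; rewrite /composable /= [RHS](grngM hk). Qed.

Lemma ginvK g : ginv (ginv g) = g.
Proof.
have sii : gsrc (ginv (ginv g)) = gsrc g.
  by rewrite [LHS]composable_inv_l; exact: esym (composable_inv_r g).
have -> : ginv (ginv g) = gmul (ginv (ginv g)) (gsrc (ginv (ginv g))).
  exact: esym (gmul_src (gP G) _).
rewrite sii gassoc; [|exact: composable_inv_l..].
by rewrite -[gmul (ginv (ginv g)) _]/(gsrc (ginv g)) composable_inv_l;
   exact: gmul_rng (gP G) g.
Qed.

Lemma grng_unit g : units (grng g).
Proof. by exists (ginv g) => //; exact: src_inv (gP G) g. Qed.

Definition unit_src g : set_type units := exist _ (gsrc g) (mem_set (imageT gsrc g)).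
Definition unit_rng g : set_type units := exist _ (grng g) (mem_set (grng_unit g)).

Definition topological_groupoid : Prop :=
  continuous (@ginv G) /\
  {within composable, continuous (fun p : G * G => gmul p.1 p.2)}.

Definition etale_groupoid : Prop :=
  [/\ topological_groupoid, @second_countable G, locally_compact [set: G],
      hausdorff_space G & local_homeomorphism unit_rng].

Definition composable_tuple n : set {ptws 'I_n -> G} :=
  [set g | forall i j : 'I_n, j = i.+1 :> nat -> gsrc (g i) = grng (g j)].

Definition nerve n : topologicalType :=
  match n with
  | 0 => set_type units
  | m.+1 => set_type (@composable_tuple m.+1)
  end.

(* With g = (g_1, ..., g_n), n = m.+2, and entries numbered from 0, this is    *)
(* the i-th face for every 0 <= i <= n: for i = 0 only the last branch occurs, *)
(* for i = n only the first.                                                   *)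
Definition face_tuple m (i : nat) (g : {ptws 'I_m.+2 -> G}) :
    {ptws 'I_m.+1 -> G} :=
  fun j => let g0 := g (widen_ord (leqnSn m.+1) j) in let g1 := g (lift ord0 j) in
    if (j.+1 < i)%N then g0 else if j.+1 == i then gmul g0 g1 else g1.

Lemma face_tuple_composable m i (g : {ptws 'I_m.+2 -> G}) :
  composable_tuple g -> composable_tuple (face_tuple i g).
Proof.
move=> gc; have step (j : 'I_m.+1) :
    gsrc (g (widen_ord (leqnSn m.+1) j)) = grng (g (lift ord0 j)) by exact: gc.
move=> j k kj; rewrite /face_tuple kj.
have kE : widen_ord (leqnSn m.+1) k = lift ord0 j by exact: val_inj.
have := step k; rewrite kE => skl; have sjl := step j.
have [ji|ij|ji] := ltngtP j.+1 i.
- have [//|ji1|ji1] := ltngtP j.+2 i; first by rewrite ltnNge ji in ji1.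
  by rewrite [RHS](rng_mul (gP G)).
- by rewrite ltnNge (leq_trans (ltnW ij)) //= gtn_eqF // ltnW.
- by rewrite -ji ltnNge leqnSn /= gtn_eqF // [LHS](src_mul (gP G)).
Qed.

Definition face n : 'I_n.+2 -> nerve n.+1 -> nerve n :=
  match n return 'I_n.+2 -> nerve n.+1 -> nerve n with
  | 0 => fun i (g : set_type (@composable_tuple 1)) =>
      if i == ord0 then unit_src (set_val g ord0) else unit_rng (set_val g ord0)
  | m.+1 => fun i (g : set_type (@composable_tuple m.+2)) =>
      exist _ (face_tuple i (set_val g))
        (mem_set (face_tuple_composable i (set_valP g)))
  end.

Definition groupoid_boundary (A : zmodType) n (f : nerve n.+1 -> A) :
    nerve n -> A :=
  fun y => \sum_(i < n.+2) pushforward (face i) f y *~ (-1) ^+ i.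

(* The chain complex C(G,A). The components other than gc_diff are             *)
(* propositions and gc_diffE determines gc_diff, so there is at most one such  *)
(* complex; its existence says that the boundary maps preserve C_c, are        *)
(* additive and square to zero.                                                *)
Record groupoid_complex (A : zmodType) := GroupoidComplex {
  gc_diff : forall n, {additive Cc (nerve n.+1) A -> Cc (nerve n) A};
  gc_diffE : forall n (f : Cc (nerve n.+1) A),
    gc_diff n f = groupoid_boundary f :> (nerve n -> A);
  gc_diffK : forall n (f : Cc (nerve n.+2) A), gc_diff n (gc_diff n.+1 f) = 0
}.

Definition complex_of_gc (A : zmodType) (C : groupoid_complex A) : complex :=
  @Complex (fun n => Cc (nerve n) A) (gc_diff C) (gc_diffK C).

Record subgroupoid := Subgroupoid {
  sub_arrows :> set G;
  sub_mul : forall g h, sub_arrows g -> sub_arrows h -> composable (g, h) ->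
    sub_arrows (gmul g h);
  sub_inv : forall g, sub_arrows g -> sub_arrows (ginv g)
}.

End groupoid_defs.

Arguments units : clear implicits.
Arguments composable : clear implicits.
Arguments nerve : clear implicits.
Coercion complex_of_gc : groupoid_complex >-> complex.

Record groupoid_hom (K G : groupoid) := GroupoidHom {
  hom_fun :> K -> G;
  hom_mul : forall g h, composable K (g, h) ->
    hom_fun (gmul g h) = gmul (hom_fun g) (hom_fun h);
  hom_inv : forall g, hom_fun (ginv g) = ginv (hom_fun g)
}.

Section nerve_map.
Variables (K G : groupoid) (j : groupoid_hom K G).

Lemma hom_src g : j (gsrc g) = gsrc (j g).
Proof. by rewrite /gsrc hom_mul ?hom_inv //; exact: src_inv (gP K) g. Qed.

Lemma hom_rng g : j (grng g) = grng (j g).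
Proof. by rewrite /grng hom_mul ?hom_inv //; exact: esym (rng_inv (gP K) g). Qed.

Lemma hom_unit x : units K x -> units G (j x).
Proof. by case=> g _ <-; exists (j g) => //; rewrite hom_src. Qed.

Lemma hom_composable_tuple n (g : {ptws 'I_n -> K}) :
  composable_tuple g -> composable_tuple ((fun i => j (g i)) : {ptws 'I_n -> G}).
Proof. by move=> gc i k ik; rewrite -hom_src -hom_rng (gc _ _ ik). Qed.

Definition nerve_map n : nerve K n -> nerve G n :=
  match n return nerve K n -> nerve G n with
  | 0 => fun x => exist _ (j (set_val x)) (mem_set (hom_unit (set_valP x)))
  | m.+1 => fun g => exist _ (fun i => j (set_val g i))
                       (mem_set (hom_composable_tuple (set_valP g)))
  end.

(* For j the inclusion of an open subgroupoid.                                 *)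
Definition extension_by_zero (A : zmodType)
    (CK : groupoid_complex K A) (CG : groupoid_complex G A)
    (i : chain_map CK CG) : Prop :=
  forall n (f : Cc (nerve K n) A),
    (forall x, (i n f : Cc (nerve G n) A) (nerve_map x) = f x) /\
    (forall y, ~ range (@nerve_map n) y -> (i n f : Cc (nerve G n) A) y = 0).

End nerve_map.

(* The arrows of P with the operations of G and the relative topology. Off     *)
(* composable pairs the product takes a dummy value.                           *)
Section subgroupoid_groupoid.
Variables (G : groupoid) (P : subgroupoid G).

Definition sub_gmul (g h : set_type P) : set_type P :=
  insubd g (gmul (set_val g) (set_val h)).

Definition sub_ginv (g : set_type P) : set_type P :=
  exist _ (ginv (set_val g)) (mem_set (sub_inv (set_valP g))).

Lemma sub_gmulE g h : composable G (set_val g, set_val h) ->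
  set_val (sub_gmul g h) = gmul (set_val g) (set_val h).
Proof.
move=> gh; rewrite /sub_gmul set_valE insubdK //.
by apply: mem_set; apply: sub_mul gh; exact: set_valP.
Qed.

Lemma sub_gsrcE g : set_val (sub_gmul (sub_ginv g) g) = gsrc (set_val g).
Proof. by rewrite sub_gmulE //; exact: src_inv (gP G) _. Qed.

Lemma sub_grngE g : set_val (sub_gmul g (sub_ginv g)) = grng (set_val g).
Proof. by rewrite sub_gmulE //; exact: esym (rng_inv (gP G) _). Qed.

Lemma sub_composable g h :
  sub_gmul (sub_ginv g) g = sub_gmul h (sub_ginv h) ->
  composable G (set_val g, set_val h).
Proof. by move/(congr1 set_val); rewrite sub_gsrcE sub_grngE. Qed.

Lemma set_val_inj : injective (@set_val G P).
Proof. exact: val_inj. Qed.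

Lemma sub_groupoid_laws : groupoid_laws sub_gmul sub_ginv.
Proof.
split.
- move=> g; apply: set_val_inj; rewrite sub_gsrcE sub_grngE.
  exact: composable_inv_l.
- move=> g; apply: set_val_inj; rewrite sub_gsrcE sub_grngE.
  exact: esym (composable_inv_r _).
- move=> g h /sub_composable gh; apply: set_val_inj.
  by rewrite !sub_gsrcE sub_gmulE //; exact: gsrcM.
- move=> g h /sub_composable gh; apply: set_val_inj.
  by rewrite !sub_grngE sub_gmulE //; exact: grngM.
- move=> g h k /sub_composable gh /sub_composable hk; apply: set_val_inj.
  have ghk := composable_mul_l gh hk; have ghk' := composable_mul_r gh hk.
  by rewrite !sub_gmulE ?sub_gmulE //; exact: gassoc.
- move=> g; apply: set_val_inj.
  rewrite sub_gmulE sub_gsrcE; first exact: gmul_src (gP G) _.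
  exact: composable_src.
- move=> g; apply: set_val_inj.
  rewrite sub_gmulE sub_grngE; first exact: gmul_rng (gP G) _.
  exact: composable_rng.
Qed.

Definition sub_groupoid : groupoid := Groupoid sub_groupoid_laws.

Lemma sub_incl_mul (g h : sub_groupoid) : composable sub_groupoid (g, h) ->
  set_val (gmul g h) = gmul (set_val g) (set_val h).
Proof. by move/sub_composable; exact: sub_gmulE. Qed.

Definition sub_incl : groupoid_hom sub_groupoid G :=
  GroupoidHom sub_incl_mul (fun=> erefl).

End subgroupoid_groupoid.

(* Delta = outside, r(Delta) = base, H = G|r(Delta) = exc_groupoid, and        *)
(* H' = G'|r(Delta) = exc_sub, as a subset of H.                               *)
Section excision.
Variables (G : groupoid) (G' : subgroupoid G).

Definition outside : set G := ~` G'.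

Definition base : set G := @grng G @` outside.

(* r : Delta -> r(Delta) is open for the quotient topology on r(Delta). *)
Definition regular_inclusion : Prop :=
  let r (g : set_type outside) := grng (set_val g) in
  forall U : set (set_type outside), open U -> open (r @^-1` (r @` U)).

Definition reduction : set G :=
  (@grng G @^-1` base) `&` (@gsrc G @^-1` base).

Lemma reduction_mul g h :
  reduction g -> reduction h -> composable G (g, h) -> reduction (gmul g h).
Proof.
move=> [rg _] [_ sh] gh; split.
  by rewrite /= [grng _](grngM gh).
by rewrite /= [gsrc _](gsrcM gh).
Qed.

Lemma reduction_inv g : reduction g -> reduction (ginv g).
Proof.
move=> [rg sg]; split.
  by rewrite /= -[grng _](composable_inv_r g).
by rewrite /= [gsrc _](composable_inv_l g).
Qed.

Definition reduction_sub : subgroupoid G :=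
  Subgroupoid reduction_mul reduction_inv.

Lemma outside_inv g : outside g -> outside (ginv g).
Proof. by move=> Dg /sub_inv; rewrite ginvK. Qed.

Lemma outside_reduction g : outside g -> reduction g.
Proof.
move=> Dg; split; first by exists g.
exists (ginv g); first exact: outside_inv.
exact: rng_inv (gP G) g.
Qed.

Definition outside_pairs : set (G * G) :=
  [set p | [/\ outside p.1, outside p.2, composable G p & sub_arrows G' (gmul p.1 p.2)]].

(* An alias of the set H, whose topology is not the relative one but that of   *)
(* the disjoint union of Delta, with the relative topology of G, and of H',    *)
(* with the quotient topology of the multiplication map outside_pairs -> H'.   *)
(* The relative topology of H' in H is therefore that quotient topology.       *)
Definition exc_arrows : Type := set_type reduction.

HB.instance Definition _ := Choice.copy exc_arrows (set_type reduction).

Definition exc_val : exc_arrows -> G := @set_val G reduction.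

Definition pairs_mul (p : set_type outside_pairs) : G :=
  gmul (set_val p).1 (set_val p).2.

Definition exc_open (U : set exc_arrows) : Prop :=
  open ((@set_val G outside) @^-1` (exc_val @` U)) /\
  open (pairs_mul @^-1` (exc_val @` U)).

Lemma exc_val_inj : injective exc_val.
Proof. exact: val_inj. Qed.

Lemma outside_pairs_reduction (p : set_type outside_pairs) :
  reduction (pairs_mul p).
Proof.
case: (set_valP p) => D1 D2 c _.
by apply: reduction_mul c; exact: outside_reduction.
Qed.

Lemma exc_val_surj g : reduction g -> range exc_val g.
Proof. by move=> rg; exists (exist _ g (mem_set rg)). Qed.

Lemma exc_openT : exc_open setT.
Proof.
have TE (S : Type) (m : S -> G) :
    (forall x, reduction (m x)) -> m @^-1` range exc_val = setT.
  by move=> mr; apply/seteqP; split => // x _; exact: exc_val_surj.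
rewrite /exc_open !TE; first by split; exact: openT.
  exact: outside_pairs_reduction.
by move=> x; exact/outside_reduction/set_valP.
Qed.

Lemma exc_openI : setI_closed exc_open.
Proof.
move=> U V [oU1 oU2] [oV1 oV2]; rewrite /exc_open.
have -> : exc_val @` (U `&` V) = (exc_val @` U) `&` (exc_val @` V).
  apply/seteqP; split; first exact: sub_image_setI.
  by move=> _ [[x Ux <-] [y Vy /exc_val_inj yx]]; exists x => //; split=> //; rewrite -yx.
by rewrite !preimage_setI; split; exact: openI.
Qed.

Lemma exc_open_bigU (I : Type) (f : I -> set exc_arrows) :
  (forall i, exc_open (f i)) -> exc_open (\bigcup_i f i).
Proof.
move=> fo; rewrite /exc_open image_bigcup !preimage_bigcup.
by split; apply: bigcup_open => i _; case: (fo i).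
Qed.

HB.instance Definition _ :=
  isOpenTopological.Build exc_arrows exc_openT exc_openI exc_open_bigU.

Definition exc_groupoid : groupoid :=
  @Groupoid exc_arrows _ _ (sub_groupoid_laws reduction_sub).

Definition exc_incl : groupoid_hom exc_groupoid G :=
  @GroupoidHom exc_groupoid G exc_val (@sub_incl_mul G reduction_sub)
    (fun=> erefl).

Definition exc_sub_arrows : set exc_groupoid := exc_val @^-1` G'.

Lemma exc_sub_mul (g h : exc_groupoid) :
  exc_sub_arrows g -> exc_sub_arrows h -> composable exc_groupoid (g, h) ->
  exc_sub_arrows (gmul g h).
Proof.
move=> G'g G'h gh; change (sub_arrows G' (exc_incl (gmul g h))).
rewrite hom_mul //; apply: sub_mul => //; exact: (@sub_composable G reduction_sub).
Qed.

Lemma exc_sub_inv (g : exc_groupoid) :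
  exc_sub_arrows g -> exc_sub_arrows (ginv g).
Proof. exact: sub_inv. Qed.

Definition exc_sub : subgroupoid exc_groupoid :=
  Subgroupoid exc_sub_mul exc_sub_inv.

End excision.

(* Main.v *)
Require Import Defs.
From HB Require Import structures.
From mathcomp Require Import all_boot all_order all_algebra.
From mathcomp Require Import all_classical all_reals topology.
From mathcomp Require Import zify.

Set Implicit Arguments.
Unset Strict Implicit.
Unset Printing Implicit Defensive.

Import GRing.Theory.

Local Open Scope classical_set_scope.
Local Open Scope ring_scope.

(** The chains of [G] modulo those of [G'] are, in degree [n], the functions on the
    complement of the nerve of [G'] in the nerve of [G]: a function that vanishes
    there is extended by zero from an open subset, and because the spaces have a
    base of compact open sets every locally constant function with compact support
    on that closed complement extends ([Cc_extension], [quot_proj_extension]). The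
    same holds for [H'] in [H]. Excision therefore amounts to two facts.

    First, [H] and [G] have the same tuples off [H'] and [G'], with the same
    topology. The set [r(Delta)] is invariant ([base_src]), so a composable tuple
    that contains an arrow of [Delta] consists of arrows of [H]. Regularity says
    that [r : Delta -> r(Delta)] is open, and it follows that the topology of [H]
    is the coarsest one for which the inclusion in [G] and the range map to
    [r(Delta)], with the quotient topology, are continuous ([exc_basis]). Along a
    net of tuples an arrow of [Delta] converges in [H] when it converges in [G],
    hence so do its end points, and hence, one entry after the other, so does the
    whole tuple ([off_cvg]).

    Second, the boundary of a chain at a tuple off [H'] is computed from tuples off
    [H'] only, and they are the same for [H] and [G] ([agree_boundary]). So the
    relation of agreeing off the subgroupoids is an additive bijective relation
    between the quotient complexes that commutes with their differentials
    ([quotient_complexes_isomorphic]), and the long exact sequences are those of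
    the two injective chain maps ([injective_long_exact_sequence]).

    All of this supposes that the complexes exist, for [G], [G'], [H] and [H']. This
    is shown for any groupoid with continuous operations, an open and locally
    injective range map, and a Hausdorff topology with a base of compact open sets
    ([ample_groupoid]): open subgroupoids inherit these properties
    ([open_hom_ample]), [H] has them ([exc_ample]), the face maps are local
    homeomorphisms because they are base changes of the range map
    ([pullback_etale]), and sums along fibres are controlled by checking them on
    constants on small compact open sets ([Cc_ind]). *)

(** * Additive relations and long exact sequences *)

(** Connecting maps and the comparison of quotient complexes are specified by
    relations between representatives; this turns such a relation into a map. *)
Lemma additive_rel (U V : zmodType) (R : U -> V -> Prop) :
  (forall u, exists v, R u v) ->
  (forall u v v', R u v -> R u v' -> v = v') ->
  (forall u u' v v', R u v -> R u' v' -> R (u - u') (v - v')) ->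
  {f : {additive U -> V} | forall u v, R u v <-> v = f u}.
Proof.
move=> Rt Rf RB; pose f u := projT1 (cid (Rt u)).
have fR u : R u (f u) := projT2 (cid (Rt u)).
have fB : zmod_morphism f by move=> u v; apply: (Rf (u - v)) => //; exact: RB.
pose F : {additive U -> V} :=
  HB.pack f (GRing.isZmodMorphism.Build U V f fB).
by exists F => u v; split=> [/Rf/(_ (fR u))//|->]; exact: fR.
Qed.

Lemma exact_atI (U V W : zmodType) (f : {additive U -> V})
    (g : {additive V -> W}) :
  (forall u, g (f u) = 0) -> (forall v, g v = 0 -> exists u, f u = v) ->
  exact_at f g.
Proof.
move=> gf fg; apply/seteqP; split => [_ [u _ <-]|v]; first exact: gf.
by move=> /fg[u <-]; exists u.
Qed.

Section homology_classes.
Variable C : complex.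

Lemma hclass_surj n (a : homology C n) : exists z, hclass z = a.
Proof. by exists (repr a); rewrite /hclass reprK. Qed.

Lemma hclassB n (z w : cycles C n) : hclass (z - w) = hclass z - hclass w.
Proof. exact: raddfB. Qed.

Lemma hclass_eq n (z w : cycles C n) :
  hclass z = hclass w <-> exists c, cdiff C n c = val z - val w.
Proof.
rewrite /hclass; split.
  by move=> /eqP; rewrite -Quotient.idealrBE => /asboolP[c cE]; exists c.
move=> [c cE]; apply/eqP; rewrite -Quotient.idealrBE; apply/asboolP.
by exists c; rewrite cE raddfB.
Qed.

Lemma hclass_eq0 n (z : cycles C n) :
  hclass z = 0 <-> exists c, cdiff C n c = val z.
Proof.
have <- : hclass (0 : cycles C n) = 0 by exact: raddf0.
by rewrite hclass_eq (raddf0 (val : cycles C n -> C n)) subr0.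
Qed.

End homology_classes.

Section quotient_complex_classes.
Variables (C D : complex) (i : chain_map C D).

Lemma quot_proj_surj n (x : quot_complex i n) : exists d, quot_proj i n d = x.
Proof. by exists (repr x); rewrite /quot_proj /= reprK. Qed.

Lemma quot_proj_eq n (d e : D n) :
  quot_proj i n d = quot_proj i n e <-> exists c, i n c = d - e.
Proof.
rewrite /quot_proj /=; split.
  by move=> /eqP; rewrite -Quotient.idealrBE => /asboolP[c cE]; exists c.
by move=> [c cE]; apply/eqP; rewrite -Quotient.idealrBE; apply/asboolP; exists c.
Qed.

Lemma quot_proj_eq0 n (d : D n) :
  quot_proj i n d = 0 <-> exists c, i n c = d.
Proof. by rewrite -(raddf0 (quot_proj i n)) quot_proj_eq subr0. Qed.

Lemma quot_cycle_lift n (z : cycles (quot_complex i) n.+1) :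
  exists d c, quot_proj i n.+1 d = val z /\ cdiff D n d = i n c.
Proof.
have [d dz] := quot_proj_surj (val z).
have /eqP := valP z; rewrite -dz -chain_funE => /quot_proj_eq0[c cE].
by exists d, c.
Qed.

Hypothesis i_inj : forall n, injective (i n).

Lemma cdiff_lift_cycle n (d : D n.+1) (c : C n) :
  cdiff D n d = i n c -> c \in @is_cycle C n.
Proof.
case: n d c => // n d c dc; apply/eqP; apply: i_inj.
by rewrite chain_funE -dc cdiffK raddf0.
Qed.

(** The zigzag of the snake lemma, as a relation between homology classes. *)
Definition connecting n (a : homology (quot_complex i) n.+1)
    (b : homology C n) : Prop :=
  exists (z : cycles (quot_complex i) n.+1) (d : D n.+1) (w : cycles C n),
    [/\ hclass z = a, hclass w = b, quot_proj i n.+1 d = val z &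
        cdiff D n d = i n (val w)].

Lemma connecting_total n (a : homology (quot_complex i) n.+1) :
  exists b, connecting a b.
Proof.
have [z za] := hclass_surj a; have [d [c [dz dc]]] := quot_cycle_lift z.
exists (hclass (Cycles (cdiff_lift_cycle dc))), z, d.
by exists (Cycles (cdiff_lift_cycle dc)).
Qed.

Lemma connectingB n (a a' : homology (quot_complex i) n.+1) b b' :
  connecting a b -> connecting a' b' -> connecting (a - a') (b - b').
Proof.
move=> [z [d [w [<- <- dz dw]]]] [z' [d' [w' [<- <- dz' dw']]]].
exists (z - z'), (d - d'), (w - w'); split; rewrite ?hclassB ?raddfB //=.
  by rewrite dz dz'.
by rewrite dw dw'.
Qed.

(** If [z] bounds in the quotient then [d] is a boundary of [D] up to the image of
    a chain [c] of [C]; its differential [w] is then the boundary of [- c]. *)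
Lemma connecting0 n (b : homology C n) : connecting 0 b -> b = 0.
Proof.
move=> [z [d [w [/hclass_eq0[x xz] <- dz dw]]]]; apply/hclass_eq0.
have [e ex] := quot_proj_surj x.
move: xz; rewrite -ex -chain_funE -dz => /quot_proj_eq[c cE].
exists (- c); apply: i_inj; rewrite -dw raddfN /= raddfN /= chain_funE cE.
by rewrite raddfB /= cdiffK sub0r opprK.
Qed.

Lemma connecting_fun n (a : homology (quot_complex i) n.+1) b b' :
  connecting a b -> connecting a b' -> b = b'.
Proof.
move=> ab ab'; apply/eqP; rewrite -subr_eq0; apply/eqP.
by apply: connecting0; rewrite -(subrr a); exact: connectingB.
Qed.

(** The snake lemma for [0 -> C -> D -> D/C -> 0]: a relative cycle is a chain
    [d] of [D] whose boundary is a cycle of [C], and the connecting map sends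
    the former to the latter. *)
Lemma injective_long_exact_sequence : long_exact_sequence i.
Proof.
have [delta deltaP] : exists delta : forall n,
    {additive homology (quot_complex i) n.+1 -> homology C n},
    forall n a b, connecting a b <-> b = delta n a.
  have conn n := additive_rel (@connecting_total n) (@connecting_fun n)
    (@connectingB n).
  by exists (fun n => sval (conn n)) => n; exact: svalP (conn n).
exists delta; split.
- by move=> n z d w dz dw; apply/esym/deltaP; exists z, d, w.
- move=> n; apply: exact_atI => [a|b].
    have [z <-] := hclass_surj a; rewrite !homology_mapE.
    apply/hclass_eq0; exists 0; rewrite raddf0 /=; apply/esym/quot_proj_eq0.
    by exists (val z).
  have [z <-] := hclass_surj b; rewrite homology_mapE => /hclass_eq0[x xz].
  have [e ex] := quot_proj_surj x.
  move: xz; rewrite -ex -chain_funE /= => /quot_proj_eq[c cE].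
  have ic : i n (- c) = val z - cdiff D n e.
    by rewrite raddfN /= cE opprB.
  have cC : - c \in @is_cycle C n.
    case: n z e x ex b c cE ic => // n z e x ex b c cE ic.
    apply/eqP/i_inj; rewrite chain_funE ic raddfB /= cdiffK subr0 raddf0.
    exact/eqP/(valP z).
  (* [z] and [i (- c)] differ by the boundary of [e]. *)
  exists (hclass (Cycles cC)); apply: (etrans (homology_mapE _ _)).
  by apply/hclass_eq; exists (- e); rewrite raddfN /= ic addrC addKr.
- move=> n; apply: exact_atI => [a|b].
    have [z <-] := hclass_surj a; rewrite homology_mapE; apply/esym/deltaP.
    exists (cycles_map (quot_proj i) z), (val z), 0; split => //.
      exact: raddf0.
    by rewrite (raddf0 (val : cycles C n -> C n)) raddf0; exact/eqP/(valP z).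
  move=> /esym/deltaP[z [d [w [<- /hclass_eq0[c cw] dz dw]]]].
  (* [d] is corrected by a chain [c] of [C] that bounds its boundary [w]. *)
  have cyc : d - i n.+1 c \in @is_cycle D n.+1.
    by apply/eqP; rewrite raddfB /= -chain_funE cw dw subrr.
  exists (hclass (Cycles cyc)); apply: (etrans (homology_mapE _ _)); congr hclass.
  apply: val_inj; rewrite -dz; apply/quot_proj_eq; exists (- c).
  by rewrite raddfN /= addrC addKr.
- move=> n; apply: exact_atI => [a|b].
    have [z [d [w [za wE dz dw]]]] := (deltaP n a _).2 erefl.
    rewrite -wE homology_mapE; apply/hclass_eq0; exists d; exact: dw.
  have [w <-] := hclass_surj b; rewrite homology_mapE => /hclass_eq0[d dw].
  have cyc : quot_proj i n.+1 d \in @is_cycle (quot_complex i) n.+1.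
    by apply/eqP; rewrite -chain_funE; apply/quot_proj_eq0; exists (val w).
  exists (hclass (Cycles cyc)); apply/esym/deltaP.
  by exists (Cycles cyc), d, w.
- apply/seteqP; split => // a _; have [z <-] := hclass_surj a.
  have [d dz] := quot_proj_surj (val z).
  have cyc : d \in @is_cycle D 0 by [].
  exists (hclass (Cycles cyc)) => //; rewrite homology_mapE.
  by congr hclass; exact: val_inj.
Qed.

End quotient_complex_classes.

Lemma bijective_homology_map (C D : complex) (phi : chain_map C D) :
  (forall n, bijective (phi n)) -> forall n, bijective (homology_map phi n).
Proof.
move=> phiB n; rewrite -setTT_bijective; split => //.
- move=> a b _ _; have [z <-] := hclass_surj a; have [w <-] := hclass_surj b.
  rewrite !homology_mapE => /hclass_eq[d dE]; apply/hclass_eq.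
  have [psi psiK phiK] := phiB n.+1; exists (psi d).
  by apply: (bij_inj (phiB n)); rewrite chain_funE phiK dE raddfB.
- move=> b _; have [w <-] := hclass_surj b.
  have [psi psiK phiK] := phiB n.
  have cyc : psi (val w) \in @is_cycle C n.
    case: n w psi psiK phiK b => // n w psi psiK phiK b.
    apply/eqP/(bij_inj (phiB n)); rewrite chain_funE phiK raddf0.
    exact/eqP/(valP w).
  exists (hclass (Cycles cyc)) => //; rewrite homology_mapE; congr hclass.
  by apply: val_inj; rewrite /= phiK.
Qed.

(** * Locally compact spaces with a base of compact open sets *)

Lemma closed_setD (X : topologicalType) (F U : set X) :
  closed F -> open U -> closed (F `\` U).
Proof.
by move=> cF oU; rewrite setDE; apply: closedI => //; exact: open_closedC.
Qed.

Lemma open_setD (X : topologicalType) (U F : set X) :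
  open U -> closed F -> open (U `\` F).
Proof.
by move=> oU cF; rewrite setDE; apply: openI => //; exact: closed_openC.
Qed.

Lemma open_sub_nbhs (X : topologicalType) (x : X) (V : set X) :
  nbhs x V -> exists W, [/\ open W, W x & W `<=` V].
Proof. by rewrite nbhsE => -[W [oW Wx] WV]; exists W. Qed.

(** Induction on a compact set: the subsets whose complement satisfies [Q]
    would otherwise form a proper filter without cluster point. *)
Lemma compact_ind (X : topologicalType) (K : set X) (Q : set (set X)) :
  compact K -> Q set0 -> (forall S T, Q S -> Q T -> Q (S `|` T)) ->
  (forall S T, S `<=` T -> Q T -> Q S) ->
  (forall x, K x -> exists2 N, nbhs x N & Q N) -> Q K.
Proof.
move=> cK Q0 QU QS Qloc; apply: contrapT => nQK.
pose F : set_system X := [set S | Q (K `\` S)].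
have FF : ProperFilter F.
  split; first by rewrite /F /= setD0.
  split; rewrite /F /=; first by rewrite setDT.
    by move=> S T QKS QKT; rewrite /F /= setDIr; exact: QU.
  by move=> S T ST; apply: QS => x [Kx nTx]; split=> // /ST.
have FK : F K by rewrite /F /= setDv.
have [x [Kx Fx]] := cK F FF FK; have [N Nx QN] := Qloc _ Kx.
have FN : F (~` N) by rewrite /F /= setDE setCK; apply: QS QN => y [].
by have [y []] := Fx _ _ FN Nx.
Qed.

(** Equivalently, a locally compact and totally disconnected Hausdorff space; a base
    of compact open sets is the form in which the constructions of locally
    constant functions use it. *)
Definition ample_space (X : topologicalType) : Prop :=
  hausdorff_space X /\
  forall (x : X) U, nbhs x U ->
    exists K, [/\ compact K, open K, K x & K `<=` U].

(** Two inductions on a compact set: separate first a point from [L], then [K]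
    from [L]. *)
Lemma compact_separation (X : topologicalType) (K L : set X) :
  hausdorff_space X -> compact K -> compact L -> K `&` L = set0 ->
  exists U V, [/\ open U, open V, K `<=` U, L `<=` V & U `&` V = set0].
Proof.
move=> hX cK cL KL0.
have sepx x : ~ L x ->
    exists U V, [/\ open U, open V, U x, L `<=` V & U `&` V = set0].
  move=> nLx; apply: (compact_ind cL (Q := fun S => exists U V,
    [/\ open U, open V, U x, S `<=` V & U `&` V = set0])).
  - exists setT, set0; split => //; [exact: openT|exact: open0|exact: setI0].
  - move=> S T [U [V [oU oV Ux SV UV]]] [U' [V' [oU' oV' U'x TV' UV']]].
    exists (U `&` U'), (V `|` V'); split.
    + exact: openI.
    + exact: openU.
    + by split.
    + by move=> y [/SV|/TV']; [left|right].
    + apply/seteqP; split => // y [[Uy U'y] [Vy|Vy]].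
        by rewrite -UV; split.
      by rewrite -UV'; split.
  - move=> S T ST [U [V [oU oV Ux TV UV]]]; exists U, V; split => //.
    exact: subset_trans TV.
  - move=> y Ly; have yx : x != y by apply/eqP => xy; apply: nLx; rewrite xy.
    have := hX; rewrite open_hausdorff.
    move=> /(_ _ _ yx)[[U V] /= [Ux Vy] [oU oV /eqP UV]].
    exists V; first by apply: open_nbhs_nbhs; split => //; rewrite inE in Vy.
    by exists U, V; split => //; rewrite inE in Ux.
apply: (compact_ind cK (Q := fun S => exists U V,
    [/\ open U, open V, S `<=` U, L `<=` V & U `&` V = set0])).
- exists set0, setT; split => //; [exact: open0|exact: openT|exact: set0I].
- move=> S T [U [V [oU oV SU LV UV]]] [U' [V' [oU' oV' TU' LV' UV']]].
  exists (U `|` U'), (V `&` V'); split.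
  + exact: openU.
  + exact: openI.
  + by move=> y [/SU|/TU']; [left|right].
  + by move=> y Ly; split; [exact: LV|exact: LV'].
  + apply/seteqP; split => // y [[Uy|Uy] [Vy V'y]].
      by rewrite -UV; split.
    by rewrite -UV'; split.
- move=> S T ST [U [V [oU oV TU LV UV]]]; exists U, V; split => //.
  exact: subset_trans TU.
- move=> x Kx; have nLx : ~ L x by move=> Lx; rewrite -[False]/(set0 x) -KL0.
  have [U [V [oU oV Ux LV UV]]] := sepx _ nLx.
  exists U; first exact: open_nbhs_nbhs.
  by exists U, V; split.
Qed.

(** The intersection [E] of the relatively clopen neighbourhoods of [x] in a
    compact set is connected: a clopen splitting of [E] spreads by compactness
    to a relatively clopen set. *)
Lemma connected_quasicomponent (X : topologicalType) (C : set X) (x : X)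
    (D : set (set X) := [set S | [/\ S `<=` C, closed S, closed (C `\` S) & S x]])
    (E : set X := [set y | forall S, D S -> S y]) :
  hausdorff_space X -> compact C -> C x ->
  connected E /\ (forall U, open U -> E `<=` U -> exists2 S, D S & S `<=` U).
Proof.
move=> hX cC Cx.
have clC : closed C by exact: compact_closed.
have DC : D C by split => //; rewrite setDv; exact: closed0.
have DI S T : D S -> D T -> D (S `&` T).
  move=> [SC clS clCS Sx] [TC clT clCT Tx]; split.
  - by move=> y [/SC].
  - exact: closedI.
  - by rewrite setDIr; exact: closedU.
  - by [].
have shrink U : open U -> E `<=` U -> exists2 S, D S & S `<=` U.
  move=> oU EU; have cK : compact (C `\` U).
    by apply: (subclosed_compact _ cC) => [|y []//]; apply: closed_setD.
  have [S DS SU] : exists2 S, D S & (C `\` U) `&` S = set0.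
    apply: (compact_ind cK (Q := fun K => exists2 S, D S & K `&` S = set0)).
    - by exists C => //; exact: set0I.
    - move=> K L [S DS KS] [T DT LT]; exists (S `&` T); first exact: DI.
      apply/seteqP; split => // y [[Ky|Ly] [Sy Ty]].
        by rewrite -KS; split.
      by rewrite -LT; split.
    - move=> K L KL [S DS LS]; exists S => //; apply/seteqP; split => // y.
      by move=> [/KL Ly Sy]; rewrite -LS; split.
    - move=> y [Cy nUy]; have nEy : ~ E y by move/EU.
      have [S DS nSy] : exists2 S, D S & ~ S y.
        apply: contrapT => nS; apply: nEy => S DS; apply: contrapT => nSy.
        by apply: nS; exists S.
      exists (~` S); last by exists S => //; exact: setICl.
      case: DS => _ clS _ _; apply: open_nbhs_nbhs; split=> //.
      exact: closed_openC.
  exists S => // y Sy; apply: contrapT => nUy; rewrite -[False]/(set0 y) -SU.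
  by split => //; split => //; case: DS => SC _ _ _; exact: SC.
split=> // B [b Bb] [O oO BO] [F cF BF].
have clE : closed E.
  rewrite (_ : E = \bigcap_(S in D) S); last by apply/seteqP; split.
  by apply: closed_bigI => S [].
have EC : E `<=` C by move=> y; apply.
have cB : compact B.
  by rewrite BF; apply: (subclosed_compact _ cC) => [|y [/EC]//]; exact: closedI.
have cB' : compact (E `\` B).
  apply: (subclosed_compact _ cC) => [|y [/EC]//].
  rewrite (_ : E `\` B = E `\` O); first exact: closed_setD.
  rewrite BO; apply/seteqP; split => y [Ey nOy]; split => //; last by case.
  by move=> Oy; apply: nOy.
have [|U [V [oU oV BU B'V UV]]] := compact_separation hX cB cB'.
  by apply/seteqP; split => // y [By []].
have [|S [SC clS clCS Sx] SUV] := shrink (U `|` V) (openU oU oV).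
  move=> y Ey; have [By|nBy] := pselect (B y); first by left; exact: BU.
  by right; exact: B'V.
have split_clopen U' V' : open U' -> open V' -> U' `&` V' = set0 ->
    S `<=` U' `|` V' -> U' x -> E `<=` U'.
  move=> oU' oV' UV' SUV' U'x y /(_ (S `&` U'))[]//; split => //.
  - by move=> z [/SC].
  - rewrite (_ : S `&` U' = S `\` V'); first exact: closed_setD.
    apply/seteqP; split => z [Sz]; first by move=> U'z; split => // V'z;
      rewrite -[False]/(set0 z) -UV'.
    by move=> nV'z; split => //; case: (SUV' _ Sz).
  - by rewrite setDIr; apply: closedU => //; exact: closed_setD.
apply/seteqP; split; first by rewrite BO => y [].
have [Ux|Vx] := SUV _ Sx.
  have EU := split_clopen _ _ oU oV UV SUV Ux.
  move=> y Ey; apply: contrapT => nBy; rewrite -[False]/(set0 y) -UV.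
  by split; [exact: EU|exact: B'V].
have EV : E `<=` V.
  by apply: (split_clopen V U) => //; [rewrite setIC|rewrite setUC].
exfalso; rewrite -[False]/(set0 b) -UV; split; [exact: BU|apply: EV].
by move: Bb; rewrite BO => -[].
Qed.

(** A connected set being a point, relatively clopen neighbourhoods of [x] in a
    compact neighbourhood [C] become arbitrarily small, and those inside the
    interior of [C] are open in [X]. *)
Lemma totally_disconnected_ample (X : topologicalType) :
  hausdorff_space X -> locally_compact [set: X] ->
  totally_disconnected [set: X] -> ample_space X.
Proof.
move=> hX lcX tdX; split=> // x U Ux.
have [C Cx [cC clC]] : exists2 C, nbhs x C & compact C /\ closed C.
  have [C Cx cC] := lcX x I; exists C => //.
  by move: Cx; rewrite withinET.
have [W [oW Wx WCU]] := open_sub_nbhs (filterI Cx Ux).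
have [cE Eshrink] := connected_quasicomponent hX cC (nbhs_singleton Cx).
have [|S [SC clS clCS Sx] SW] := Eshrink W oW.
  move=> y Ey; suff -> : y = x by [].
  have := tdX x I; set E := (E in connected E) in cE.
  have : connected_component [set: X] x y by exists E => //; split => // S [].
  by move=> + tdx; rewrite tdx.
exists S; split=> //.
- exact: (subclosed_compact _ cC).
- rewrite (_ : S = W `\` (C `\` S)); first exact: open_setD.
  apply/seteqP; split => y; first by move=> Sy; split; [exact: SW|case].
  move=> [Wy nCS]; apply: contrapT => nSy; apply: nCS; split=> //.
  by case: (WCU _ Wy).
- by move=> y /SW/WCU[].
Qed.

(** * Local homeomorphisms *)

Section etale_maps.
Variables X Y : topologicalType.
Implicit Type p : X -> Y.

Definition open_map p : Prop := forall x V, nbhs x V -> nbhs (p x) (p @` V).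

Definition injective_on p (U : set X) : Prop :=
  forall a b, U a -> U b -> p a = p b -> a = b.

(** Pointwise form of a local homeomorphism. It does not ask for an open set on
    which [p] is at once injective, continuous and open, so that each clause can
    be checked by a filter argument. *)
Definition etale_map p : Prop :=
  [/\ continuous p, open_map p &
      forall x : X, exists2 U, nbhs x U & injective_on p U].

Lemma injective_onS p (U V : set X) :
  U `<=` V -> injective_on p V -> injective_on p U.
Proof. by move=> UV pV a b /UV Va /UV Vb; exact: pV. Qed.

Lemma open_map_image p (V : set X) : open_map p -> open V -> open (p @` V).
Proof.
move=> op oV; rewrite openE => _ [x Vx <-]; apply: op.
exact: open_nbhs_nbhs.
Qed.

(** The inverse of [p] from [p @` U] to [U] is continuous, because [p] is open. *)
Lemma compact_injective_preimage p (U : set X) (K : set Y) :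
  open_map p -> open U -> injective_on p U -> compact K -> K `<=` p @` U ->
  compact (U `&` p @^-1` K).
Proof.
move=> op oU pinj cK KU F FF FW.
have pFK : (p @ F) K by apply: (@filterS _ F _ _ _ _ FW) => x [].
have [y [Ky pFy]] := cK _ (fmap_proper_filter p FF) pFK.
have [u Uu uy] := KU _ Ky.
exists u; split=> [|S V FS Vu]; first by split => //; rewrite /preimage /= uy.
have pS : (p @ F) (p @` (S `&` (U `&` p @^-1` K))).
  by apply: (@filterS _ F _ _ _ _ (filterI FS FW)) => x ?; exists x.
have pV : nbhs y (p @` (V `&` U)).
  by rewrite -uy; apply: op; apply: filterI => //; exact: open_nbhs_nbhs.
have [_ [[s [Ss [Us _]] <-] [v [Vv Uv] vs]]] := pFy _ _ pS pV.
by exists s; split => //; rewrite (pinj s v).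
Qed.

(** Compact open sets are lifted along local sections of [p]. *)
Lemma etale_ample p : etale_map p -> hausdorff_space X -> ample_space Y ->
  ample_space X.
Proof.
move=> [cp op lp] hX [hY aY]; split=> // x V Vx.
have [U Ux pU] := lp x.
have [W [oW Wx WVU]] := open_sub_nbhs (filterI Vx Ux).
have pW : injective_on p W by apply: injective_onS pU => y /WVU[].
have [|K [cK oK Kx KW]] := aY (p x) (p @` W).
  by apply: op; exact: open_nbhs_nbhs.
exists (W `&` p @^-1` K); split.
- exact: compact_injective_preimage.
- by apply: openI => //; apply: open_comp => // ? _; exact: cp.
- by split.
- by move=> y [/WVU[]].
Qed.

Lemma continuous_injective_hausdorff p :
  continuous p -> injective p -> hausdorff_space Y -> hausdorff_space X.
Proof.
move=> cp ip hY x y xy; apply/ip/hY => S T pS pT.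
have [z [Sz Tz]] := xy _ _ (cp _ _ pS) (cp _ _ pT).
by exists (p z).
Qed.

End etale_maps.

(** * Compactly supported locally constant functions *)

Section locally_constant_functions.
Variables (X : topologicalType) (A : zmodType).
Implicit Types (f g : X -> A) (B : set X).

Lemma compactly_supportedP f : f \in @compactly_supported X A <->
  (forall x : X, \forall y \near x, f y = f x) /\ compact [set x | f x != 0].
Proof.
have clf : (forall x, \forall y \near x, f y = f x) -> closed [set x | f x != 0].
  move=> lf x xf; have [y [/= fy <-]] := xf _ (lf x); exact: fy.
split.
  move=> /asboolP[cf kf].
  have lf x : \forall y \near x, f y = f x := cf x _ (discrete_set1 _).
  by split => //; move: kf; have /closure_id <- := clf lf.
move=> [lf kf]; apply/asboolP; split; last by have /closure_id <- := clf lf.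
move=> x U /nbhs_singleton Ux; change (\forall y \near x, U (f y)).
by apply: filterS (lf x) => y ->.
Qed.

Definition cutoff B f : X -> A := patch (fun=> 0) B f.

Lemma cutoff_in B f x : B x -> cutoff B f x = f x.
Proof. by move=> /mem_set Bx; rewrite /cutoff patchE Bx. Qed.

Lemma cutoff_out B f x : ~ B x -> cutoff B f x = 0.
Proof. by move=> nBx; rewrite /cutoff patchE memNset. Qed.

Lemma cutoff_cc B f : open B -> closed B -> f \in @compactly_supported X A ->
  cutoff B f \in @compactly_supported X A.
Proof.
move=> oB cB /compactly_supportedP[lf kf]; apply/compactly_supportedP; split.
  move=> x; have [Bx|nBx] := pselect (B x).
    by apply: filterS2 (open_nbhs_nbhs (conj oB Bx)) (lf x) => y By fy;
      rewrite !cutoff_in.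
  apply: filterS (open_nbhs_nbhs (conj (closed_openC cB) nBx)) => y nBy.
  by rewrite !cutoff_out.
rewrite (_ : [set x | _] = B `&` [set x | f x != 0]).
  by rewrite setIC; exact: compact_closedI.
apply/seteqP; split => x /=.
  have [Bx|nBx] := pselect (B x); first by rewrite cutoff_in.
  by rewrite cutoff_out // eqxx.
by move=> [Bx fx]; rewrite cutoff_in.
Qed.

Lemma bump_cc B (a : A) : hausdorff_space X -> compact B -> open B ->
  cutoff B (fun=> a) \in @compactly_supported X A.
Proof.
move=> hX cB oB; have clB := compact_closed hX cB.
apply/compactly_supportedP; split.
  move=> x; have [Bx|nBx] := pselect (B x).
    by apply: filterS (open_nbhs_nbhs (conj oB Bx)) => y By; rewrite !cutoff_in.
  apply: filterS (open_nbhs_nbhs (conj (closed_openC clB) nBx)) => y nBy.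
  by rewrite !cutoff_out.
have [->|a0] := eqVneq a 0.
  rewrite (_ : [set x | _] = set0); first exact: compact0.
  apply/seteqP; split => // x /=; have [Bx|nBx] := pselect (B x).
    by rewrite cutoff_in // eqxx.
  by rewrite cutoff_out // eqxx.
rewrite (_ : [set x | _] = B) //; apply/seteqP; split => x /=.
  have [//|nBx] := pselect (B x).
  by rewrite cutoff_out // eqxx.
by move=> Bx; rewrite cutoff_in.
Qed.

(** The group of these functions is generated by the constants on arbitrarily
    small compact open sets. *)
Lemma Cc_ind (P : set (X -> A)) (small : set (set X)) :
  ample_space X -> (forall x : X, exists2 N, nbhs x N & small N) ->
  (forall S T, S `<=` T -> small T -> small S) ->
  P 0 -> (forall f g, P f -> P g -> P (f + g)) ->
  (forall B a, compact B -> open B -> small B -> P (cutoff B (fun=> a))) ->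
  forall f, f \in @compactly_supported X A -> P f.
Proof.
move=> [hX aX] small_nbhs smallS P0 PD Pbump f /compactly_supportedP[lf kf].
suff [T [cT oT fT PT]] : exists T, [/\ compact T, open T,
    [set x | f x != 0] `<=` T &
    forall D, compact D -> open D -> D `<=` T -> P (cutoff D f)].
  rewrite (_ : f = cutoff T f); first exact: PT.
  apply/funext => x; have [Tx|nTx] := pselect (T x); first by rewrite cutoff_in.
  by rewrite cutoff_out //; case: (eqVneq (f x) 0) => // fx; case: nTx; exact: fT.
apply: (compact_ind kf (Q := fun S => exists T, [/\ compact T, open T, S `<=` T &
    forall D, compact D -> open D -> D `<=` T -> P (cutoff D f)])).
- exists set0; split => //; [exact: compact0|exact: open0|].
  move=> D _ _ D0; rewrite (_ : cutoff D f = 0) //; apply/funext => x.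
  by rewrite cutoff_out // => /D0.
- move=> S S' [T [cT oT ST PT]] [T' [cT' oT' ST' PT']].
  exists (T `|` T'); split; [exact: compactU|exact: openU|exact: setUSS|].
  move=> D cD oD DT; have clT := compact_closed hX cT.
  rewrite (_ : cutoff D f = cutoff (D `&` T) f + cutoff (D `\` T) f).
    apply: PD; first apply: PT.
    + exact: compact_closedI.
    + exact: openI.
    + by move=> x [].
    apply: PT'.
    + by rewrite setDE; apply: compact_closedI => //; exact: open_closedC.
    + exact: open_setD.
    + by move=> x [/DT[]].
  apply/funext => x; rewrite [RHS]/=.
  change (cutoff D f x = cutoff (D `&` T) f x + cutoff (D `\` T) f x).
  have [Dx|nDx] := pselect (D x); last first.
    by rewrite !cutoff_out ?addr0 // => -[].
  have [Tx|nTx] := pselect (T x).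
    rewrite (cutoff_in _ Dx) cutoff_in; last by split.
    by rewrite cutoff_out ?addr0 // => -[].
  rewrite (cutoff_in _ Dx) cutoff_out; last by move=> [].
  by rewrite add0r cutoff_in.
- move=> S S' SS' [T [cT oT ST PT]]; exists T; split => //.
  exact: subset_trans ST.
- move=> x _; have [N Nx sN] := small_nbhs x.
  have [K [cK oK Kx KN]] := aX x _ (filterI Nx (lf x)).
  exists K; first by apply: open_nbhs_nbhs.
  exists K; split => // D cD oD DK.
  rewrite (_ : cutoff D f = cutoff D (fun=> f x)).
    by apply: Pbump => //; apply: smallS sN => y /DK/KN[].
  apply/funext => y; have [Dy|nDy] := pselect (D y); last by rewrite !cutoff_out.
  by rewrite !cutoff_in //; have [] := KN _ (DK _ Dy).
Qed.

(** Functions on a subset [Z] extend. Around each point of the support a compact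
    open set of [X] carries a constant extension; two extensions are glued by
    letting the first one prevail where both are defined. *)
Lemma Cc_extension (Z : set X) g : ample_space X ->
  (forall x : X, Z x -> exists2 N, nbhs x N & forall y, N y -> Z y -> g y = g x) ->
  compact (Z `&` [set x | g x != 0]) ->
  exists2 f, f \in @compactly_supported X A & forall x, Z x -> f x = g x.
Proof.
move=> [hX aX] lg kg.
suff [T [f [ST fcc fg fT]]] : exists T f,
    [/\ Z `&` [set x | g x != 0] `<=` T, f \in @compactly_supported X A,
        forall x, Z x -> T x -> f x = g x & forall x, ~ T x -> f x = 0].
  exists f => // x Zx; have [Tx|nTx] := pselect (T x); first exact: fg.
  by rewrite fT //; case: (eqVneq (g x) 0) => // gx; case: nTx; exact: ST.
have [T [f []]] : exists T f, [/\ clopen T, Z `&` [set x | g x != 0] `<=` T,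
    f \in @compactly_supported X A, forall x, Z x -> T x -> f x = g x &
    forall x, ~ T x -> f x = 0].
  apply: (compact_ind kg (Q := fun S => exists T f, [/\ clopen T, S `<=` T,
      f \in @compactly_supported X A, forall x, Z x -> T x -> f x = g x &
      forall x, ~ T x -> f x = 0])).
  - exists set0, 0; split => //; [exact: clopen0|exact: rpred0].
  - move=> S S' [T [f [[oT cT] ST fcc fg fT]]].
    move=> [T' [f' [[oT' cT'] ST' fcc' fg' fT']]].
    exists (T `|` T'), (f + cutoff (~` T) f').
    have E x : (f + cutoff (~` T) f') x = f x + cutoff (~` T) f' x by [].
    split.
    + by split; [exact: openU|exact: closedU].
    + exact: setUSS.
    + apply: rpredD => //; apply: cutoff_cc => //; first exact: closed_openC.
      exact: open_closedC.
    + move=> x Zx TTx; rewrite E; have [Tx|nTx] := pselect (T x).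
        by rewrite cutoff_out ?addr0 ?fg //; apply.
      by rewrite cutoff_in // fT // add0r fg' //; case: TTx.
    + move=> x nTTx; have nTx : ~ T x by move=> ?; apply: nTTx; left.
      have nT'x : ~ T' x by move=> ?; apply: nTTx; right.
      by rewrite E fT // cutoff_in // fT' // addr0.
  - move=> S S' SS' [T [f [clT ST fcc fg fT]]]; exists T, f; split => //.
    exact: subset_trans ST.
  - move=> x [Zx gx]; have [N Nx gN] := lg _ Zx.
    have [K [cK oK Kx KN]] := aX x _ Nx.
    exists K; first exact: open_nbhs_nbhs.
    exists K, (cutoff K (fun=> g x)); split => //.
    + by split=> //; exact: compact_closed.
    + exact: bump_cc.
    + by move=> y Zy Ky; rewrite cutoff_in // gN //; exact: KN.
    + by move=> y nKy; rewrite cutoff_out.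
by move=> *; exists T, f.
Qed.

End locally_constant_functions.

(** * Summation along the fibres of a local homeomorphism *)

Section pushforward.
Variables (X Y : topologicalType) (A : zmodType) (p : X -> Y).
Implicit Types f g : X -> A.

Definition finite_fibres f : Prop :=
  forall y, finite_set (p @^-1` [set y] `&` [set x | f x != 0]).

Lemma pushforward_support (S : set X) f y :
  p @^-1` [set y] `&` [set x | f x != 0] `<=` S -> S `<=` p @^-1` [set y] ->
  pushforward p f y = \sum_(x \in S) f x.
Proof.
move=> fyS Sy; apply/esym/fsbig_widen => //.
by move=> x [px nSx]; case: (eqVneq (f x) 0) => // fx; case: nSx; exact: fyS.
Qed.

Lemma finite_fibresD f g :
  finite_fibres f -> finite_fibres g -> finite_fibres (f + g).
Proof.
move=> ff fg y; have : finite_set ((p @^-1` [set y] `&` [set x | f x != 0]) `|`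
   (p @^-1` [set y] `&` [set x | g x != 0])) by rewrite finite_setU; split.
apply: sub_finite_set => x [px fgx].
have [fx|fx] := eqVneq (f x) 0; last by left.
right; split => //; move: fgx; apply: contraNN => /eqP gx.
by rewrite /= !fctE fx gx addr0.
Qed.

Lemma pushforwardD f g : finite_fibres f -> finite_fibres g ->
  pushforward p (f + g) = pushforward p f + pushforward p g.
Proof.
move=> ff fg; apply/funext => y.
change (pushforward p (f + g) y = pushforward p f y + pushforward p g y).
pose S := (p @^-1` [set y] `&` [set x | f x != 0]) `|`
   (p @^-1` [set y] `&` [set x | g x != 0]).
have fS : finite_set S by rewrite finite_setU; split.
rewrite !(@pushforward_support S) ?fsbig_split //.
- by move=> x [px gx]; right.
- by move=> x [[]|[]].
- by move=> x [px fx]; left.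
- by move=> x [[]|[]].
- move=> x [px fgx]; have [fx|fx] := eqVneq (f x) 0; last by left.
  right; split => //; move: fgx; apply: contraNN => /eqP gx.
  by rewrite /= !fctE fx gx addr0.
- by move=> x [[]|[]].
Qed.

Lemma pushforward0 : pushforward p (0 : X -> A) = 0.
Proof. by apply/funext => y; apply: fsbig1. Qed.

Lemma finite_fibres_bump B (a : A) :
  injective_on p B -> finite_fibres (cutoff B (fun=> a)).
Proof.
move=> pB y; have sub : p @^-1` [set y] `&` [set x | cutoff B (fun=> a) x != 0]
    `<=` p @^-1` [set y] `&` B.
  move=> x [px /= Bx]; split => //; apply: contrapT => nBx.
  by rewrite cutoff_out // eqxx in Bx.
apply: (sub_finite_set sub).
have [[x [<- Bx]]|nx] := pselect (exists x, p x = y /\ B x).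
  by apply: sub_finite_set (finite_set1 x) => z [pz Bz]; exact: pB.
by rewrite (_ : _ `&` _ = set0) //; apply/seteqP; split => // x [px Bx];
  apply: nx; exists x.
Qed.

(** Together with [Cc_ind] this reduces every statement on [pushforward] to
    images of compact open sets on which [p] is injective. *)
Lemma pushforward_bump B (a : A) : injective_on p B ->
  pushforward p (cutoff B (fun=> a)) = cutoff (p @` B) (fun=> a).
Proof.
move=> pB; apply/funext => y; have [[x Bx <-]|nBy] := pselect ((p @` B) y).
  rewrite cutoff_in; last by exists x.
  rewrite /pushforward -(@fsbig_widen _ _ _ _ [set x]).
  - by rewrite fsbig_set1 cutoff_in.
  - by move=> _ ->.
  - move=> z [pz nzx]; apply: cutoff_out => Bz; apply: nzx; exact: pB.
rewrite cutoff_out //; apply: fsbig1 => x px; rewrite cutoff_out // => Bx.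
by apply: nBy; exists x.
Qed.

Hypothesis (aX : ample_space X) (ep : etale_map p).

Lemma etale_small (x : X) : exists2 N, nbhs x N & injective_on p N.
Proof. by case: ep. Qed.

Lemma Cc_finite_fibres f : f \in @compactly_supported X A -> finite_fibres f.
Proof.
apply: (Cc_ind aX etale_small (@injective_onS _ _ p)).
- move=> y; apply: sub_finite_set (finite_set0 X) => x [_ /=].
  by rewrite eqxx.
- exact: finite_fibresD.
- by move=> B a _ _; exact: finite_fibres_bump.
Qed.

Lemma pushforward_cc f : hausdorff_space Y -> f \in @compactly_supported X A ->
  pushforward p f \in @compactly_supported Y A.
Proof.
move=> hY fcc; suff [] : finite_fibres f /\
  pushforward p f \in @compactly_supported Y A by [].
have [cp op _] := ep; move: f fcc.
apply: (Cc_ind aX etale_small (@injective_onS _ _ p)).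
- by split; [exact/Cc_finite_fibres/rpred0|rewrite pushforward0 rpred0].
- move=> f g [ff pf] [fg pg]; split; first exact: finite_fibresD.
  by rewrite pushforwardD // rpredD.
- move=> B a cB oB pB; split; first exact: finite_fibres_bump.
  rewrite pushforward_bump //; apply: bump_cc => //.
    by apply: continuous_compact => //; exact: continuous_subspaceT.
  exact: open_map_image.
Qed.

Lemma pushforwardB f g : f \in @compactly_supported X A ->
  g \in @compactly_supported X A ->
  pushforward p (f - g) = pushforward p f - pushforward p g.
Proof.
move=> fcc gcc; apply/eqP; rewrite eq_sym subr_eq -pushforwardD ?subrK //.
  by apply: Cc_finite_fibres; exact: rpredB.
exact: Cc_finite_fibres.
Qed.

End pushforward.

(** Functoriality is additive in [f], and for a constant on a compact open set
    [B] on which [q] and then [p] are injective both sides are the constant on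
    [p (q B)]. *)
Lemma pushforward_comp (X Y Z : topologicalType) (A : zmodType) (q : X -> Y)
    (p : Y -> Z) (f : X -> A) :
  ample_space X -> ample_space Y -> etale_map q -> etale_map p ->
  f \in @compactly_supported X A ->
  pushforward p (pushforward q f) = pushforward (p \o q) f.
Proof.
move=> aX aY eq ep fcc; have [hY _] := aY.
suff [] : [/\ finite_fibres q f, finite_fibres (p \o q) f,
    finite_fibres p (pushforward q f) &
    pushforward p (pushforward q f) = pushforward (p \o q) f] by [].
move: f fcc; apply: (Cc_ind aX (small := fun N : set X =>
    injective_on q N /\ injective_on p (q @` N))).
- move=> x; have [N Nx qN] := etale_small eq x.
  have [U Ux pU] := etale_small ep (q x).
  have [cq _ _] := eq; exists (N `&` q @^-1` U).
    by apply: filterI => //; exact: cq.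
  split; first by apply: injective_onS qN => y [].
  by apply: injective_onS pU => _ [y [_ Uy] <-].
- move=> S T ST [qT pT]; split; first exact: injective_onS qT.
  by apply: injective_onS pT; exact: image_subset.
- have f0 (U V : topologicalType) (r : U -> V) : finite_fibres r (0 : U -> A).
    by move=> y; apply: sub_finite_set (finite_set0 U) => x [_ /=]; rewrite eqxx.
  by split; rewrite ?pushforward0 //; exact: f0.
- move=> f g [qf pqf pf fE] [qg pqg pg gE]; split.
  + exact: finite_fibresD.
  + exact: finite_fibresD.
  + by rewrite pushforwardD //; exact: finite_fibresD.
  + by rewrite !pushforwardD // fE gE.
- move=> B a cB oB [qB pB].
  have pqB : injective_on (p \o q) B.
    move=> x y Bx By pq; apply: qB => //.
    by apply: pB pq; [exists x|exists y].
  split; [exact: finite_fibres_bump|exact: finite_fibres_bump| |].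
    by rewrite pushforward_bump //; exact: finite_fibres_bump.
  by rewrite !pushforward_bump // image_comp.
Qed.

(** Extension by zero is the push-forward along an injective map, so that the
    functoriality of [pushforward] makes it a chain map. *)
Lemma pushforward_injective (X Y : topologicalType) (A : zmodType) (j : X -> Y)
    (f : X -> A) : injective j ->
  (forall x, pushforward j f (j x) = f x) /\
  (forall y, ~ range j y -> pushforward j f y = 0).
Proof.
move=> ij; split=> [x|y ny]; last first.
  by apply: fsbig1 => x jx; exfalso; apply: ny; exists x.
rewrite /pushforward (_ : j @^-1` [set j x] = [set x]) ?fsbig_set1 //.
by apply/seteqP; split => z /= => [/ij|->].
Qed.

(** A function that vanishes off an open subspace is the extension by zero of
    its restriction: its support is compact and open, hence compact in the
    subspace. *)
Lemma pushforward_open_image (X Y : topologicalType) (A : zmodType) (j : X -> Y)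
    (f : Y -> A) : continuous j -> open_map j -> injective j ->
  f \in @compactly_supported Y A -> (forall y, ~ range j y -> f y = 0) ->
  exists2 g, g \in @compactly_supported X A & pushforward j g = f.
Proof.
move=> cj oj ij /compactly_supportedP[lf kf] f0; exists (f \o j).
  apply/compactly_supportedP; split=> [x|]; first exact: cj (lf (j x)).
  rewrite (_ : [set x | _] = setT `&` j @^-1` [set y | f y != 0]); last first.
    by rewrite setTI.
  apply: compact_injective_preimage => //; [exact: openT|by move=> a b _ _ /ij|].
  by move=> y fy; apply: contrapT => /f0 /eqP; rewrite (negbTE fy).
have [pj pj0] := pushforward_injective (f \o j) ij.
apply/funext => y; have [[x _ <-]|ny] := pselect (range j y); first exact: pj.
by rewrite pj0 // f0.
Qed.

(** * Groupoids with a base of compact open bisections *)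

Section groupoid_algebra.
Variable K : groupoid.
Implicit Types g h k : K.

Lemma gsrc_inv g : gsrc (ginv g) = grng g.
Proof. exact: composable_inv_l. Qed.

Lemma grng_inv g : grng (ginv g) = gsrc g.
Proof. exact: esym (composable_inv_r g). Qed.

Lemma grng_rng g : grng (grng g) = grng g.
Proof. by rewrite /grng; exact: (grngM (composable_inv_r g)). Qed.

Lemma grng_src g : grng (gsrc g) = gsrc g.
Proof. by rewrite -grng_inv grng_rng. Qed.

Lemma grng_of_unit g : units K g -> grng g = g.
Proof. by move=> [h _ <-]; exact: grng_src. Qed.

Lemma gmulKV g h : grng g = grng h -> gmul g (gmul (ginv g) h) = h.
Proof.
move=> gh; rewrite gassoc.
- by rewrite -/(grng g) gh; exact: (gmul_rng (gP K)).
- exact: composable_inv_r.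
- by rewrite /composable /= gsrc_inv.
Qed.

Lemma gmulVK g h : composable K (g, h) -> gmul (ginv g) (gmul g h) = h.
Proof.
move=> gh; rewrite gassoc //; last exact: composable_inv_l.
by rewrite -/(gsrc g) [gsrc g]gh; exact: (gmul_rng (gP K)).
Qed.

Lemma composable_invl g h : grng g = grng h -> composable K (ginv g, h).
Proof. by rewrite /composable /= gsrc_inv. Qed.

End groupoid_algebra.

(** The part of the structure of a totally disconnected etale groupoid on which
    its chain complex depends. Continuity of the product is stated with
    neighbourhoods of the two factors, to be fed with nets of composable
    pairs. *)
Record ample_groupoid (K : groupoid) : Prop := AmpleGroupoid {
  ag_space : ample_space K;
  ag_inv : continuous (@ginv K);
  ag_mul : forall g h : K, composable K (g, h) -> forall V, nbhs (gmul g h) V ->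
    exists U W, [/\ nbhs g U, nbhs h W &
      forall g' h', U g' -> W h' -> composable K (g', h') -> V (gmul g' h')];
  ag_open : open_map (@grng K);
  ag_inj : forall x : K, exists2 U, nbhs x U & injective_on (@grng K) U
}.

Section ample_groupoids.
Variables (K : groupoid) (aK : ample_groupoid K).

Lemma gmul_cvg (T : Type) (F : set_system T) (f g : T -> K) (a b : K) :
  Filter F -> f @ F --> a -> g @ F --> b -> composable K (a, b) ->
  (forall t, composable K (f t, g t)) ->
  (fun t => gmul (f t) (g t)) @ F --> gmul a b.
Proof.
move=> FF fa gb ab fg V Vab.
have [U [W [aU bW UWV]]] := ag_mul aK ab Vab.
apply: (@filterS _ F _ (f @^-1` U `&` g @^-1` W)).
  by move=> t [Ut Wt]; exact: UWV.
by apply: filterI; [exact: fa|exact: gb].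
Qed.

Lemma ginv_cvg (T : Type) (F : set_system T) (f : T -> K) (a : K) :
  Filter F -> f @ F --> a -> (fun t => ginv (f t)) @ F --> ginv a.
Proof. by move=> FF fa; apply: (cvg_comp _ _ fa); exact: (ag_inv aK). Qed.

Lemma grng_cvg (T : Type) (F : set_system T) (f : T -> K) (a : K) :
  Filter F -> f @ F --> a -> (fun t => grng (f t)) @ F --> grng a.
Proof.
move=> FF fa; apply: gmul_cvg => //; first exact: ginv_cvg.
  exact: composable_inv_r.
by move=> t; exact: composable_inv_r.
Qed.

Lemma gsrc_cvg (T : Type) (F : set_system T) (f : T -> K) (a : K) :
  Filter F -> f @ F --> a -> (fun t => gsrc (f t)) @ F --> gsrc a.
Proof.
move=> FF fa; rewrite -grng_inv; under eq_fun do rewrite -grng_inv.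
by apply: grng_cvg; exact: ginv_cvg.
Qed.

Lemma ginv_continuous (X : topologicalType) (f : X -> K) :
  continuous f -> continuous (fun x => ginv (f x)).
Proof. by move=> cf x; apply: ginv_cvg (cf x). Qed.

Lemma grng_continuous (X : topologicalType) (f : X -> K) :
  continuous f -> continuous (fun x => grng (f x)).
Proof. by move=> cf x; apply: grng_cvg (cf x). Qed.

Lemma gsrc_continuous (X : topologicalType) (f : X -> K) :
  continuous f -> continuous (fun x => gsrc (f x)).
Proof. by move=> cf x; apply: gsrc_cvg (cf x). Qed.

Lemma units_open : open (units K).
Proof.
rewrite (_ : units K = @grng K @` setT).
  by apply: open_map_image; [exact: ag_open|exact: openT].
apply/seteqP; split => x; first by move=> /grng_of_unit <-; exists x.
by move=> [g _ <-]; exact: grng_unit.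
Qed.

End ample_groupoids.

Lemma set_type_cvg (T : Type) (X : topologicalType) (D : set X)
    (F : set_system T) (f : T -> set_type D) (x : set_type D) : Filter F ->
  (fun t => set_val (f t)) @ F --> set_val x -> f @ F --> x.
Proof.
move=> FF fx V /open_sub_nbhs[W [[O oO <-] Ox OV]].
apply: (@filterS _ F _ _ _ _ (fx O _)); first by move=> t; exact: OV.
exact: open_nbhs_nbhs.
Qed.

Lemma set_val_continuous (X : topologicalType) (D : set X) :
  continuous (@set_val X D).
Proof. exact: initial_continuous. Qed.

Lemma set_type_open (X : topologicalType) (D : set X) (U : set (set_type D)) :
  open U -> exists2 O, open O & forall x, U x <-> O (set_val x).
Proof. by move=> [O oO <-]; exists O. Qed.

(** The codomain of [unit_rng] being the space of units, one needs that units
    form an open set: if [g] and [r g] both lie in a set on which [r] is injective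
    then [g = r g]. *)
Lemma etale_groupoid_ample (G : groupoid) : etale_groupoid G ->
  totally_disconnected [set: G] -> ample_groupoid G.
Proof.
move=> [[cinv cmul] _ lcG hG lhG] tdG.
have mulP (g h : G) : composable G (g, h) -> forall V, nbhs (gmul g h) V ->
    exists U W, [/\ nbhs g U, nbhs h W &
      forall g' h', U g' -> W h' -> composable G (g', h') -> V (gmul g' h')].
  move=> gh V Vgh; have /subspace_continuousP/(_ _ gh _ Vgh) := cmul.
  move=> [[U W] /= [gU hW] UWV]; exists U, W; split => // g' h' Ug' Wh' g'h'.
  exact: (UWV (g', h')).
have crng : continuous (@grng G).
  move=> g V Vg; have [U [W [gU gW UWV]]] := mulP _ _ (composable_inv_r g) _ Vg.
  apply: filterS (filterI gU (cinv _ _ gW)) => g' [Ug' Wg'].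
  by apply: UWV => //; exact: composable_inv_r.
have rng_inj (U : set G) : set_inj U (@unit_rng G) -> injective_on (@grng G) U.
  move=> iU a b Ua Ub ab; apply: iU; rewrite ?inE //; exact: val_inj.
have oU : open (units G).
  rewrite openE => u Gu; have ru := grng_of_unit Gu.
  have [U [[oU Uu] iU _ _]] := lhG u.
  apply: (@filterS _ _ _ (U `&` @grng G @^-1` U)).
    move=> g [Ug Urg]; have <- : grng g = g; last exact: grng_unit.
    by apply: rng_inj iU _ _ Urg Ug _; exact: grng_rng.
  apply: filterI; first exact: open_nbhs_nbhs.
  by apply: crng; rewrite ru; exact: open_nbhs_nbhs.
split => //.
- exact: totally_disconnected_ample.
- move=> x V Vx; have [U [oUx _ _ opU]] := lhG x.
  have [W [oW Wx WVU]] := open_sub_nbhs (filterI Vx (open_nbhs_nbhs oUx)).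
  have [O oO WO] := set_type_open (opU W oW (fun y Wy => (WVU y Wy).2)).
  apply: (@filterS _ _ _ (O `&` units G)).
    move=> y [Oy uy]; have [z Wz zy] : (@unit_rng G @` W) (exist _ y (mem_set uy)).
      by apply/WO.
    exists z; first exact: (WVU _ Wz).1.
    by move/(congr1 set_val): zy; rewrite !set_valE.
  apply: filterI; apply: open_nbhs_nbhs; split => //; last exact: grng_unit.
  by have /WO := imageP (@unit_rng G) Wx.
- move=> x; have [U [oUx iU _ _]] := lhG x.
  by exists U; [exact: open_nbhs_nbhs|exact: rng_inj].
Qed.

(** * Nerves *)

Section nerve_entries.
Variable K : groupoid.

(** Entries are indexed by natural numbers, which keeps shifts of indices free of
    casts between ordinals. In degree 0 the single entry is the unit itself. *)
Definition entry n : nerve K n -> nat -> K :=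
  match n return nerve K n -> nat -> K with
  | 0 => fun x _ => set_val x
  | m.+1 => fun x k => set_val x (inord k)
  end.

Lemma nerve_eq n (x y : nerve K n) :
  (forall k, (k <= n.-1)%N -> entry x k = entry y k) -> x = y.
Proof.
case: n x y => [|n] x y xy.
  by apply: val_inj; have := xy 0 isT; rewrite /= !set_valE.
apply: val_inj; rewrite -!set_valE; apply/funext => i.
by have := xy i (ltn_ord i); rewrite /= inord_val.
Qed.

Lemma entry_unit (x : nerve K 0) k : grng (entry x k) = entry x k.
Proof. by apply: grng_of_unit; exact: set_valP. Qed.

Lemma entry_composable n (x : nerve K n.+1) k : (k < n)%N ->
  composable K (entry x k, entry x k.+1).
Proof.
move=> kn; apply: (set_valP x); rewrite !inordK //.
by rewrite ltnS ltnW.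
Qed.

Lemma nerve0_ex (u : K) : units K u -> exists x : nerve K 0, entry x 0 = u.
Proof. by move=> Ku; exists (exist _ u (mem_set Ku)); rewrite /= set_valE. Qed.

Lemma nerve_ex n (e : nat -> K) :
  (forall k, (k < n)%N -> composable K (e k, e k.+1)) ->
  exists x : nerve K n.+1, forall k, (k <= n)%N -> entry x k = e k.
Proof.
move=> ec; pose g : {ptws 'I_n.+1 -> K} := fun i => e i.
have gc : composable_tuple g.
  by move=> i j ij; rewrite /g ij; apply: ec; rewrite -ltnS -ij.
exists (exist _ g (mem_set gc)) => k kn.
by rewrite /= set_valE /= /g inordK.
Qed.

(** The topology of a nerve, in every degree, is that of convergence of all
    entries. *)
Lemma nerve_cvg n (T : Type) (F : set_system T) (f : T -> nerve K n)
    (x : nerve K n) : Filter F ->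
  (forall k, (k <= n.-1)%N -> (fun t => entry (f t) k) @ F --> entry x k) ->
  f @ F --> x.
Proof.
case: n f x => [|n] f x FF fx; apply: set_type_cvg; first exact: (fx 0).
apply/cvg_sup => i V.
move=> [_ [[O oO <-] Ox OV]].
apply: (@filterS _ F _ _ _ _ (fx i (ltn_ord i) O _)).
  by move=> t /= Ot; apply: OV; move: Ot; rewrite /= inord_val.
by rewrite /= inord_val; exact: open_nbhs_nbhs.
Qed.

Lemma entry_continuous n k : continuous (fun x : nerve K n => entry x k).
Proof.
case: n => [|n] x; first exact: set_val_continuous.
have c1 := @set_val_continuous _ (@composable_tuple K n.+1) x.
have c2 := @proj_continuous _ (fun=> K : topologicalType) (inord k : 'I_n.+1)
  (set_val x).
move=> V xV; exact: (c1 _ (c2 V xV)).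
Qed.

Lemma nerve_hausdorff n : hausdorff_space K -> hausdorff_space (nerve K n).
Proof.
move=> hK x y xy; apply: nerve_eq => k _; apply: hK => S T Sx Ty.
have [z [Sz Tz]] := xy _ _ (entry_continuous Sx) (entry_continuous Ty).
by exists (entry z k).
Qed.

(** The face maps on sequences of arrows, without their composability. *)
Definition face_entry (i : nat) (e : nat -> K) (k : nat) : K :=
  if (k.+1 < i)%N then e k
  else if k.+1 == i then gmul (e k) (e k.+1) else e k.+1.

Lemma entry_face m (i : 'I_m.+3) (x : nerve K m.+2) k : (k <= m)%N ->
  entry (face i x) k = face_entry i (entry x) k.
Proof.
move=> km; rewrite /= set_valE /= /face_tuple /face_entry inordK //.
have -> : widen_ord (leqnSn m.+1) (inord k) = inord k.
  by apply: val_inj; rewrite /= !inordK // ltnW.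
have -> // : lift ord0 (inord k : 'I_m.+1) = inord k.+1 :> 'I_m.+2.
by apply: val_inj; rewrite /= /bump /= !inordK.
Qed.

Lemma entry_face0 (i : 'I_2) (x : nerve K 1) k :
  entry (face i x) k = if i == ord0 then gsrc (entry x 0) else grng (entry x 0).
Proof.
rewrite /= set_valE /= (_ : inord 0 = ord0); last first.
  by apply: val_inj; rewrite /= inordK.
by case: ifP.
Qed.

End nerve_entries.

Arguments entry : simpl never.

(** * Face maps are local homeomorphisms *)

(** The [i]-th face of a tuple forgets its [i]-th vertex. A tuple is recovered
    from that face together with one arrow [c] that ends at an end point [t] of
    an edge of the face and starts at the forgotten vertex, and any arrow ending
    at [t] occurs: the face map is a base change of the range map, whence it is
    a local homeomorphism. *)
Lemma pullback_etale (X Y : topologicalType) (K : groupoid) (d : X -> Y)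
    (c : X -> K) (t : Y -> K) : ample_groupoid K -> hausdorff_space X ->
  continuous d -> continuous c -> continuous t ->
  (forall x, grng (c x) = t (d x)) ->
  (forall y k, grng k = t y -> exists2 x, d x = y & c x = k) ->
  (forall (F : set_system X) x, Filter F ->
     d @ F --> d x -> c @ F --> c x -> F --> x) ->
  etale_map d.
Proof.
move=> aK hX cd cc ct rc ex lim.
(* The principal filter at [x'] converges to [x] as soon as [d] and [c] agree. *)
have inj x x' : d x = d x' -> c x = c x' -> x = x'.
  move=> dx cx; apply: hX => S T xS xT; exists x'; split; last exact: nbhs_singleton.
  have x'x : principal_filter x' --> x.
    by apply: lim; [rewrite dx|rewrite cx] => V /nbhs_singleton Vx' _ ->.
  by have /(_ x' erefl) := x'x S xS.
split=> // [x V Vx|x].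
  pose F : set_system X := [set S | exists Wd Wc, [/\ nbhs (d x) Wd,
    nbhs (c x) Wc & d @^-1` Wd `&` c @^-1` Wc `<=` S]].
  have FF : Filter F.
    split.
    - by exists setT, setT; split => //; exact: filterT.
    - move=> S S' [Wd [Wc [Wdx Wcx WS]]] [Wd' [Wc' [Wdx' Wcx' WS']]].
      exists (Wd `&` Wd'), (Wc `&` Wc'); split; [exact: filterI..|].
      by move=> y [[? ?] [? ?]]; split; [exact: WS|exact: WS'].
    - move=> S S' SS' [Wd [Wc [Wdx Wcx WS]]]; exists Wd, Wc; split => //.
      exact: subset_trans SS'.
  have Fx : F --> x.
    apply: lim => W xW.
      by exists W, setT; split => [||y []] //; exact: filterT.
    by exists setT, W; split => [||y []] //; exact: filterT.
  have [Wd [Wc [Wdx Wcx WV]]] := Fx V Vx.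
  have tW : nbhs (d x) (t @^-1` (@grng K @` Wc)).
    by apply: ct; rewrite -rc; exact: (ag_open aK).
  apply: filterS (filterI Wdx tW) => y [Wdy [k Wck ky]].
  have [z zy zk] := ex _ _ ky; exists z => //.
  by apply: WV; split; rewrite /preimage /= ?zy ?zk.
have [U Ucx iU] := ag_inj aK (c x).
exists (c @^-1` U) => [|a b Ua Ub ab]; first exact: cc.
by apply: inj => //; apply: iU => //; rewrite !rc ab.
Qed.

Section faces.
Variables (K : groupoid) (aK : ample_groupoid K).

Let hK : hausdorff_space K := (ag_space aK).1.

Lemma entry_cvg n (x : nerve K n) k :
  (fun y : nerve K n => entry y k) @ x --> entry x k.
Proof. exact: entry_continuous. Qed.

Lemma face_continuous n (i : 'I_n.+2) : continuous (@face K n i).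
Proof.
case: n i => [|m] i x;
  apply: (@nerve_cvg _ _ _ (nbhs x) (face i) _ (nbhs_filter x)) => k km.
  under eq_fun do rewrite entry_face0; rewrite entry_face0.
  case: ifP => _; first by apply: (gsrc_cvg aK); exact: entry_cvg.
  by apply: (grng_cvg aK); exact: entry_cvg.
under eq_fun do rewrite entry_face //.
rewrite entry_face // /face_entry; case: ifP => _; first exact: entry_cvg.
case: ifP => _; last exact: entry_cvg.
apply: (gmul_cvg aK) => [|||y]; [exact: entry_cvg|exact: entry_cvg| |].
  exact: entry_composable.
exact: entry_composable.
Qed.

Lemma nerve1_ex (k : K) : exists x : nerve K 1, entry x 0 = k.
Proof.
have [//|x xk] := @nerve_ex K 0 (fun=> k).
by exists x; exact: xk.
Qed.

Lemma etale_face0 (i : 'I_2) : etale_map (@face K 0 i).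
Proof.
have e0 (y : nerve K 0) k : entry y k = entry y 0 by [].
have [i0|i1] := eqVneq i ord0.
- apply: (pullback_etale (c := fun x => ginv (entry x 0))
    (t := fun y => entry y 0) aK).
  + exact: nerve_hausdorff.
  + exact: face_continuous.
  + by apply: (ginv_continuous aK); exact: entry_continuous.
  + exact: entry_continuous.
  + by move=> x; rewrite entry_face0 i0 eqxx grng_inv.
  + move=> y k ky; have [x xk] := nerve1_ex (ginv k).
    exists x; last by rewrite xk ginvK.
    apply: nerve_eq => l _; rewrite entry_face0 i0 eqxx xk gsrc_inv ky.
    by rewrite (e0 y l).
  + move=> F x FF _ cx; apply: nerve_cvg => k; rewrite leqn0 => /eqP ->.
    rewrite -[entry x 0]ginvK; under eq_fun do rewrite -[entry _ 0]ginvK.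
    exact: ginv_cvg.
- apply: (pullback_etale (c := fun x => entry x 0) (t := fun y => entry y 0) aK).
  + exact: nerve_hausdorff.
  + exact: face_continuous.
  + exact: entry_continuous.
  + exact: entry_continuous.
  + by move=> x; rewrite entry_face0 (negbTE i1).
  + move=> y k ky; have [x xk] := nerve1_ex k.
    exists x => //; apply: nerve_eq => l _.
    by rewrite entry_face0 (negbTE i1) xk ky (e0 y l).
  + move=> F x FF _ cx; apply: nerve_cvg => k; rewrite leqn0 => /eqP ->.
    exact: cx.
Qed.

(** Convergence of a face, read entry by entry; [h] is the expected value of the
    [k]-th entry. *)
Lemma face_entry_lim m (i : 'I_m.+3) (F : set_system (nerve K m.+2))
    (x : nerve K m.+2) k (h : nerve K m.+2 -> K) : Filter F ->
  face i @ F --> face i x -> (k <= m)%N ->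
  (forall z, face_entry i (entry z) k = h z) -> h @ F --> h x.
Proof.
move=> FF dx km hE.
have -> : h = (fun z => entry (face i z) k).
  by apply/funext => z; rewrite entry_face.
by move=> V /(@entry_continuous K m.+1 k) eV; exact: (dx _ eV).
Qed.

Lemma etale_first_face m : etale_map (@face K m.+1 ord0).
Proof.
have fE (e : nat -> K) k : face_entry (ord0 : 'I_m.+3) e k = e k.+1 by [].
apply: (pullback_etale (c := fun x => ginv (entry x 0))
  (t := fun y => grng (entry y 0)) aK).
- exact: nerve_hausdorff.
- exact: face_continuous.
- by apply: (ginv_continuous aK); exact: entry_continuous.
- by apply: (grng_continuous aK); exact: entry_continuous.
- move=> x; rewrite entry_face // /face_entry /= grng_inv.
  exact: (entry_composable x).
- move=> y k ky.
  have [|x xe] := @nerve_ex K m.+1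
      (fun l => if l is l'.+1 then entry y l' else ginv k).
    case=> [_|l lm]; last exact: entry_composable.
    by rewrite /composable /= gsrc_inv.
  exists x; last by rewrite xe // ginvK.
  by apply: nerve_eq => l lm; rewrite entry_face // /face_entry /= xe.
- move=> F x FF dx cx; apply: nerve_cvg => -[_|k km].
    rewrite -[entry x 0]ginvK; under eq_fun do rewrite -[entry _ 0]ginvK.
    exact: ginv_cvg.
  exact: (@face_entry_lim m ord0 F x k (fun z => entry z k.+1)).
Qed.

Lemma etale_last_face m : etale_map (@face K m.+1 ord_max).
Proof.
have fE (e : nat -> K) k : (k <= m)%N -> face_entry m.+2 e k = e k.
  by move=> km; rewrite /face_entry ltnS ltnS km.
apply: (pullback_etale (c := fun x => entry x m.+1)
  (t := fun y => gsrc (entry y m)) aK).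
- exact: nerve_hausdorff.
- exact: face_continuous.
- exact: entry_continuous.
- by apply: (gsrc_continuous aK); exact: entry_continuous.
- move=> x; rewrite entry_face // fE //.
  by apply/esym/(entry_composable x).
- move=> y k ky.
  have [|x xe] := @nerve_ex K m.+1 (fun l => if (l <= m)%N then entry y l else k).
    move=> l lm; rewrite /= -ltnS lm; case: ifP => lm'.
      exact: entry_composable.
    have -> : l = m by apply/eqP; rewrite eqn_leq -ltnS lm /= leqNgt lm'.
    by rewrite /composable /= ky.
  exists x; last by rewrite xe // ltnn.
  by apply: nerve_eq => l lm; rewrite entry_face // fE // xe ?lm // ltnW.
- move=> F x FF dx cx; apply: nerve_cvg => k.
  rewrite leq_eqVlt => /orP[/eqP ->|km]; first exact: cx.
  by apply: (@face_entry_lim m ord_max F x k (fun z => entry z k)) => // z; exact: fE.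
Qed.

(** The face multiplies the entries [g_(i-1)] and [g_i], counted from 0. With
    [c = g_(i-1)] the second factor is recovered as [c^-1] times the product. *)
Lemma etale_inner_face m (i : 'I_m.+3) : (0 < i)%N -> (i < m.+2)%N ->
  etale_map (@face K m.+1 i).
Proof.
case: i => [[//|i] ilt] _ im.
have fl (e : nat -> K) k : (k < i)%N -> face_entry i.+1 e k = e k.
  by move=> ki; rewrite /face_entry ltnS ki.
have fe (e : nat -> K) : face_entry i.+1 e i = gmul (e i) (e i.+1).
  by rewrite /face_entry ltnn eqxx.
have fg (e : nat -> K) k : (i < k)%N -> face_entry i.+1 e k = e k.+1.
  by move=> ki; rewrite /face_entry ltnS ltnNge ltnW //= eqSS gtn_eqF.
have im' : (i <= m)%N := im.
apply: (pullback_etale (c := fun x => entry x i)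
  (t := fun y => grng (entry y i)) aK).
- exact: nerve_hausdorff.
- exact: face_continuous.
- exact: entry_continuous.
- by apply: (grng_continuous aK); exact: entry_continuous.
- move=> x; rewrite entry_face // fe; apply/esym/grngM.
  exact: entry_composable.
- move=> y k ky; pose e l := if (l < i)%N then entry y l else if l == i then k
    else if l == i.+1 then gmul (ginv k) (entry y i) else entry y l.-1.
  have el l : (l < i)%N -> e l = entry y l by move=> li; rewrite /e li.
  have ei : e i = k by rewrite /e ltnn eqxx.
  have eSi : e i.+1 = gmul (ginv k) (entry y i).
    by rewrite /e ltnNge leqnSn /= gtn_eqF // eqxx.
  have eg l : (i < l)%N -> e l.+1 = entry y l.
    by move=> li; rewrite /e ltnNge leqW ?(ltnW li) //= gtn_eqF ?leqW // eqSS gtn_eqF.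
  have kc := composable_invl ky.
  have [|x xe] := @nerve_ex K m.+1 e.
    move=> l lm; have [li|il|->] := ltngtP l i.
    + rewrite (el l) //; have [l1i|il1|l1i] := ltngtP l.+1 i.
      * rewrite el //; apply: entry_composable; exact: leq_trans (ltnW l1i) im'.
      * by rewrite ltnNge li in il1.
      * rewrite l1i ei /composable /= ky -l1i.
        by apply: entry_composable; rewrite l1i.
    + case: l lm il => // l lm; rewrite ltnS leq_eqVlt => /orP[/eqP Eil|il].
        rewrite -Eil in lm *; rewrite eSi eg //.
        have := entry_composable y (k := i) lm.
        by rewrite /composable /= => <-; exact: (gsrcM kc).
      by rewrite !eg ?leqW //; exact: entry_composable.
    + rewrite ei eSi /composable /=; apply/esym.
      by rewrite [LHS](grngM kc) grng_inv.
  exists x; last by rewrite xe ?ei // leqW.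
  apply: nerve_eq => l lm; rewrite entry_face //; have [li|il|->] := ltngtP l i.
  + by rewrite fl // xe ?el // leqW.
  + by rewrite fg // xe ?eg.
  + by rewrite fe !xe // ?ei ?eSi ?gmulKV // leqW.
- move=> F x FF dx cx; apply: nerve_cvg => k; rewrite [(k <= _)%N]/= => km.
  have [ki|ik|->] := ltngtP k i; last exact: cx.
    have km' : (k <= m)%N := leq_trans (ltnW ki) im'.
    by apply: (@face_entry_lim m (Ordinal ilt) F x k (fun z => entry z k)) => // z;
      exact: fl.
  case: k km ik => // k km; rewrite ltnS leq_eqVlt => /orP[/eqP <-|ik]; last first.
    by apply: (@face_entry_lim m (Ordinal ilt) F x k (fun z => entry z k.+1)) => // z;
      exact: fg.
  have xc (z : nerve K m.+2) : composable K (entry z i, entry z i.+1).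
    exact: entry_composable.
  rewrite -(gmulVK (xc x)); under eq_fun do rewrite -(gmulVK (xc _)).
  apply: (gmul_cvg aK) => [|||z].
  + exact: ginv_cvg.
  + by apply: (@face_entry_lim m (Ordinal ilt) F x i
      (fun z => gmul (entry z i) (entry z i.+1))) => // z; exact: fe.
  + by apply: composable_invl; apply/esym/grngM.
  + by apply: composable_invl; apply/esym/grngM.
Qed.

Lemma etale_face n (i : 'I_n.+2) : etale_map (@face K n i).
Proof.
case: n i => [|m] i; first exact: etale_face0.
have [i0|ipos] := posnP i.
  by rewrite (_ : i = ord0); [exact: etale_first_face|exact: val_inj].
have [im|im] := ltnP i m.+2; first exact: etale_inner_face.
rewrite (_ : i = ord_max); first exact: etale_last_face.
by apply/val_inj/eqP; rewrite eqn_leq im -ltnS ltn_ord.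
Qed.

(** Induction on [n]: compact open sets are lifted along a face map. *)
Lemma nerve_ample n : ample_space (nerve K n).
Proof.
elim: n => [|n IHn]; last first.
  exact: etale_ample (etale_face ord0) (nerve_hausdorff hK) IHn.
apply: (@etale_ample _ K (@set_val K (units K))) (ag_space aK);
  last exact: (@nerve_hausdorff K 0).
have oU := units_open aK; split.
- exact: set_val_continuous.
- move=> x V /open_sub_nbhs[W [oW Wx WV]].
  have [O oO WO] := set_type_open oW.
  apply: (@filterS _ _ _ (O `&` units K)).
    move=> y [Oy uy]; exists (exist _ y (mem_set uy)); last by rewrite set_valE.
    by apply/WV/WO; rewrite set_valE.
  apply: filterI; apply: open_nbhs_nbhs; split => //; first exact/WO.
  exact: set_valP.
- move=> x; exists setT; first exact: filterT.
  by move=> a b _ _; rewrite !set_valE; exact: val_inj.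
Qed.

End faces.

(** * The chain complex of an ample groupoid *)

Section push.
Variables (X Y : topologicalType) (A : zmodType) (p : X -> Y).
Hypotheses (aX : ample_space X) (hY : hausdorff_space Y) (ep : etale_map p).

Definition push_fun (f : Cc X A) : Cc Y A :=
  MkCc (pushforward_cc aX ep hY (valP f)).

Lemma push_fun_is_zmod_morphism : zmod_morphism push_fun.
Proof.
move=> f g; apply: val_inj.
exact: (pushforwardB aX ep (valP f) (valP g)).
Qed.

#[local] HB.instance Definition _ :=
  GRing.isZmodMorphism.Build (Cc X A) (Cc Y A) push_fun
    push_fun_is_zmod_morphism.

Definition push : {additive Cc X A -> Cc Y A} := push_fun.

End push.

Section evaluation.
Variables (X : topologicalType) (A : zmodType) (x : X).

Definition evaluation (f : Cc X A) : A := f x.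

Lemma evaluation_is_zmod_morphism : zmod_morphism evaluation.
Proof. by []. Qed.

HB.instance Definition _ := GRing.isZmodMorphism.Build (Cc X A) A evaluation
  evaluation_is_zmod_morphism.

End evaluation.

(** The usual cancellation in the square of a simplicial boundary: the term
    [(i, j)] with [i < j] is opposite to the term [(j - 1, i)]. *)
Lemma alternating_double_sum (V : zmodType) n (F : nat -> nat -> V) :
  (forall i j, (i < j)%N -> (j <= n.+1)%N -> F i j = F j.-1 i) ->
  \sum_(i < n.+1) (\sum_(j < n.+2) F i j *~ (-1) ^+ j) *~ (-1) ^+ i = 0.
Proof.
move=> FE; pose G i j := F i j *~ ((-1) ^+ j * (-1) ^+ i).
have -> : \sum_(i < n.+1) (\sum_(j < n.+2) F i j *~ (-1) ^+ j) *~ (-1) ^+ i =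
   \sum_(i < n.+1) \sum_(j < n.+2) G i j.
  by apply: eq_bigr => i _; rewrite mulrz_suml; apply: eq_bigr => j _; rewrite -mulrzA.
have split_ij (i : 'I_n.+1) : \sum_(j < n.+2) G i j =
    \sum_(j < n.+1 | (j <= i)%N) G i j - \sum_(j < n.+1 | (i <= j)%N) G j i.
  rewrite (bigID (fun j : 'I_n.+2 => (j <= i)%N)) /=; congr (_ + _).
    rewrite big_mkcond big_ord_recr /= leqNgt ltn_ord addr0 [RHS]big_mkcond.
    exact: eq_bigr.
  rewrite big_mkcond big_ord_recl /= add0r [in RHS]big_mkcond /= -sumrN.
  apply: eq_bigr => j _; rewrite /bump /= add1n -ltnNge ltnS.
  case: ifP => [ij|_]; last by rewrite oppr0.
  rewrite /G FE ?ltnS //; last by rewrite -ltnS.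
  by rewrite exprS mulN1r mulNr mulrNz mulrC.
rewrite (eq_bigr _ (fun i _ => split_ij i)) sumrB.
by rewrite (exchange_big_dep xpredT) //= subrr.
Qed.

Section face_entries.
Variable K : groupoid.
Implicit Type e : nat -> K.

Lemma face_entry_lt e i k : (k.+1 < i)%N -> face_entry i e k = e k.
Proof. by rewrite /face_entry => ->. Qed.

Lemma face_entry_eq e k : face_entry k.+1 e k = gmul (e k) (e k.+1).
Proof. by rewrite /face_entry ltnn eqxx. Qed.

Lemma face_entry_gt e i k : (i <= k)%N -> face_entry i e k = e k.+1.
Proof. by rewrite /face_entry => ik; rewrite ltnNge leqW //= gtn_eqF. Qed.

Lemma face_entryC e i j k : (i < j)%N ->
  (forall l, (l <= k.+1)%N -> composable K (e l, e l.+1)) ->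
  face_entry i (face_entry j e) k = face_entry j.-1 (face_entry i e) k.
Proof.
case: j => // j; rewrite ltnS /= => ij ec.
have ck : composable K (e k, e k.+1) by exact: ec.
have ck1 : composable K (e k.+1, e k.+2) by exact: ec.
have [ki|] := ltnP k.+1 i.
  by rewrite !face_entry_lt //; lia.
rewrite leq_eqVlt ltnS => /orP[/eqP Ei|ik].
  rewrite Ei in ij *; rewrite face_entry_eq face_entry_lt ?ltnS //.
  move: ij; rewrite leq_eqVlt => /orP[/eqP <-|ij].
    rewrite !face_entry_eq gassoc //.
    by rewrite face_entry_gt.
  by rewrite [RHS]face_entry_lt // face_entry_eq face_entry_lt.
rewrite face_entry_gt //.
have [kj|] := ltnP k.+1 j.
  by rewrite face_entry_lt // [RHS]face_entry_lt // face_entry_gt.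
rewrite leq_eqVlt => /orP[/eqP ->|kj].
  by rewrite !face_entry_eq !face_entry_gt // leqW.
by rewrite !face_entry_gt //; lia.
Qed.

End face_entries.

(** The simplicial identities. In lowest degree they are identities between
    sources and ranges, so that case is separate. *)
Lemma face_face (K : groupoid) n (i j : nat) (x : nerve K n.+2) :
  (i < j)%N -> (j <= n.+2)%N ->
  face (inord i : 'I_n.+2) (face (inord j : 'I_n.+3) x) =
  face (inord j.-1 : 'I_n.+2) (face (inord i : 'I_n.+3) x).
Proof.
move=> ij jn; have im : (i <= n.+1)%N by lia.
have jn' : (j.-1 <= n.+1)%N by lia.
apply: nerve_eq => k kn; case: n x jn im jn' kn => [|n] x jn im jn' kn.
  have xc : composable K (entry x 0, entry x 1) by exact: entry_composable.
  rewrite !entry_face0 !entry_face // !inordK //; last by lia.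
  have ord0E l : (l < 2)%N -> ((inord l : 'I_2) == ord0) = (l == 0)%N.
    by move=> l2; rewrite -val_eqE /= inordK.
  rewrite !ord0E //; move: ij jn.
  case: i im => [|[|//]] _; case: j jn' => [|[|[|//]]] _ // _ _ /=.
  - by rewrite face_entry_eq face_entry_gt //; exact: (gsrcM xc).
  - by rewrite face_entry_lt // face_entry_eq; exact: esym (grngM xc).
have E (l : nat) (y : nerve K n.+2) : (l <= n.+2)%N ->
    entry (face (inord l : 'I_n.+3) y) k = face_entry l (entry y) k.
  by move=> ln; rewrite entry_face // inordK.
have E' (l : nat) : (l <= n.+3)%N ->
    forall k', (k' <= n.+1)%N ->
    entry (face (inord l : 'I_n.+4) x) k' = face_entry l (entry x) k'.
  by move=> ln k' kn'; rewrite entry_face // inordK.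
have F (l : nat) (e e' : nat -> K) : (forall k', (k' <= n.+1)%N -> e k' = e' k') ->
    face_entry l e k = face_entry l e' k.
  by move=> ee; rewrite /face_entry !ee //; lia.
rewrite !E // (F _ _ _ (E' _ _)) // (F j.-1 _ _ (E' _ _)) //; last by lia.
apply: face_entryC => // l lk; apply: entry_composable.
by rewrite /= in kn; lia.
Qed.

Section groupoid_chain_complex.
Variables (K : groupoid) (aK : ample_groupoid K) (A : zmodType).

Definition face_push n (i : 'I_n.+2) :
    {additive Cc (nerve K n.+1) A -> Cc (nerve K n) A} :=
  push A (nerve_ample aK n.+1) (nerve_ample aK n).1 (etale_face aK i).

Definition chain_boundary n (f : Cc (nerve K n.+1) A) : Cc (nerve K n) A :=
  \sum_(i < n.+2) face_push i f *~ (-1) ^+ i.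

Lemma chain_boundary_is_zmod_morphism n : zmod_morphism (@chain_boundary n).
Proof.
move=> f g; rewrite /chain_boundary -sumrB; apply: eq_bigr => i _.
by rewrite raddfB mulrzBl.
Qed.

HB.instance Definition _ n := GRing.isZmodMorphism.Build
  (Cc (nerve K n.+1) A) (Cc (nerve K n) A) (@chain_boundary n)
  (@chain_boundary_is_zmod_morphism n).

Lemma chain_boundaryE n (f : Cc (nerve K n.+1) A) :
  chain_boundary f = groupoid_boundary f :> (nerve K n -> A).
Proof.
apply/funext => y; rewrite -[LHS]/(evaluation y (chain_boundary f)).
by rewrite raddf_sum; apply: eq_bigr => i _; rewrite raddfMz.
Qed.

Lemma face_push_comp n (i : 'I_n.+2) (j : 'I_n.+3) (f : Cc (nerve K n.+2) A) :
  face_push i (face_push j f) =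
  pushforward (face i \o face j) f :> (nerve K n -> A).
Proof.
exact: (pushforward_comp (nerve_ample aK n.+2) (nerve_ample aK n.+1)
  (etale_face aK j) (etale_face aK i) (valP f)).
Qed.

Lemma chain_boundaryK n (f : Cc (nerve K n.+2) A) :
  chain_boundary (chain_boundary f) = 0.
Proof.
rewrite -[RHS](@alternating_double_sum _ n.+1
  (fun i j => face_push (inord i : 'I_n.+2) (face_push (inord j : 'I_n.+3) f))).
  rewrite /chain_boundary; apply: eq_bigr => i _; congr (_ *~ _).
  rewrite raddf_sum; apply: eq_bigr => j _.
  by rewrite raddfMz !inord_val.
move=> i j ij jn; apply: val_inj; rewrite [LHS]face_push_comp [RHS]face_push_comp.
by congr pushforward; apply/funext => x; exact: face_face.
Qed.

Definition chain_complex : groupoid_complex K A :=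
  @GroupoidComplex K A (fun n => @chain_boundary n : {additive _ -> _})
    chain_boundaryE chain_boundaryK.

End groupoid_chain_complex.

(** * Open subgroupoids *)

Lemma nerve_basis (K : groupoid) n (x : nerve K n) (V : set (nerve K n)) :
  nbhs x V -> exists2 W : nat -> set K, forall k, nbhs (entry x k) (W k) &
    forall y, (forall k, (k <= n.-1)%N -> W k (entry y k)) -> V y.
Proof.
pose F : set_system (nerve K n) := [set S | exists2 W : nat -> set K,
  forall k, nbhs (entry x k) (W k) &
  forall y, (forall k, (k <= n.-1)%N -> W k (entry y k)) -> S y].
have FF : Filter F.
  split.
  - by exists (fun=> setT) => // k; exact: filterT.
  - move=> S T [W xW WS] [W' xW' WT]; exists (fun k => W k `&` W' k).
      by move=> k; exact: filterI.
    by move=> y yW; split; [apply: WS => k kn|apply: WT => k kn]; case: (yW k kn).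
  - by move=> S T ST [W xW WS]; exists W => // y /WS /ST.
suff : F --> x by exact.
apply: (@nerve_cvg _ _ _ F id) => k kn W xW.
exists (fun l => if l == k then W else setT).
  by move=> l; case: eqP => [->//|_]; exact: filterT.
by move=> y /(_ k kn); rewrite eqxx.
Qed.

Section nerve_maps.
Variables (K G : groupoid) (j : groupoid_hom K G).

Lemma entry_nerve_map n (x : nerve K n) k :
  entry (nerve_map j x) k = j (entry x k).
Proof. by case: n x => [|n] x; rewrite /entry /= set_valE. Qed.

Lemma hom_composable g h : composable K (g, h) -> composable G (j g, j h).
Proof. by move=> gh; rewrite /composable /= -hom_src -hom_rng; congr (j _). Qed.

Lemma face_nerve_map n (i : 'I_n.+2) (x : nerve K n.+1) :
  face i (nerve_map j x) = nerve_map j (face i x).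
Proof.
apply: nerve_eq => k kn; rewrite entry_nerve_map; case: n i x kn => [|n] i x kn.
  by rewrite !entry_face0 entry_nerve_map (fun_if j) hom_src hom_rng.
rewrite !entry_face // /face_entry !entry_nerve_map !(fun_if j).
by rewrite hom_mul //; exact: entry_composable.
Qed.

Lemma nerve_map_continuous n : continuous j -> continuous (@nerve_map K G j n).
Proof.
move=> cj x; apply: (@nerve_cvg _ _ _ (nbhs x) _ _ (nbhs_filter x)) => k kn.
rewrite entry_nerve_map; under eq_fun do rewrite entry_nerve_map.
by move=> V /cj /(@entry_continuous K n k).
Qed.

Hypothesis j_inj : injective j.

Lemma nerve_map_inj n : injective (@nerve_map K G j n).
Proof.
move=> x y xy; apply: nerve_eq => k _; apply: j_inj.
by rewrite -!entry_nerve_map xy.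
Qed.

(** Composability is reflected by an injective homomorphism, so preimages of the
    entries can be chosen independently. *)
Lemma nerve_map_lift n (y : nerve G n) (V : nat -> set K) :
  (forall k, (k <= n.-1)%N -> (j @` V k) (entry y k)) ->
  exists2 x, nerve_map j x = y & forall k, (k <= n.-1)%N -> V k (entry x k).
Proof.
case: n y => [|n] y yV.
  have [u Vu uy] := yV 0 isT.
  have [|x xu] := @nerve0_ex K u.
    rewrite (_ : u = grng u); first exact: grng_unit.
    by apply: j_inj; rewrite hom_rng uy entry_unit.
  exists x => [|[]// _]; last by rewrite xu.
  by apply: nerve_eq => -[]// _; rewrite entry_nerve_map xu.
pose e k := if pselect (k <= n)%N is left kn then sval (cid2 (yV k kn)) else
  sval (cid2 (yV 0 isT)).
have eP k : (k <= n)%N -> V k (e k) /\ j (e k) = entry y k.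
  by move=> kn; rewrite /e; case: pselect => // kn'; case: cid2.
have [|x xe] := @nerve_ex K n e.
  move=> k kn; apply: j_inj; rewrite hom_src hom_rng.
  rewrite (eP k (ltnW kn)).2 (eP k.+1 kn).2; exact: entry_composable.
exists x => [|k kn]; last by rewrite xe //; exact: (eP k kn).1.
by apply: nerve_eq => k kn; rewrite entry_nerve_map xe // (eP k kn).2.
Qed.

Lemma range_nerve_map n (y : nerve G n) : range (@nerve_map K G j n) y <->
  forall k, (k <= n.-1)%N -> range j (entry y k).
Proof.
split; first by move=> [x _ <-] k _; rewrite entry_nerve_map; exists (entry x k).
by move=> /(@nerve_map_lift n y (fun=> setT))[x xy _]; exists x.
Qed.

Hypotheses (j_cont : continuous j) (j_open : open_map j).

Lemma nerve_map_open n : open_map (@nerve_map K G j n).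
Proof.
move=> x V /nerve_basis[W xW WV].
have : \forall y \near nerve_map j x, forall k : 'I_n.-1.+1, (j @` W k) (entry y k).
  apply: filter_forall => k; apply: (@entry_continuous G n k).
  by rewrite entry_nerve_map; apply: j_open; exact: xW.
apply: filterS => y yW.
have [|z zy zW] := @nerve_map_lift n y W.
  by move=> k kn; exact: (yW (Ordinal (kn : (k < n.-1.+1)%N))).
by exists z => //; exact: WV.
Qed.

Lemma etale_nerve_map n : etale_map (@nerve_map K G j n).
Proof.
split; [exact: nerve_map_continuous|exact: nerve_map_open|move=> x].
by exists setT => [|a b _ _ /nerve_map_inj//]; exact: filterT.
Qed.

(** An injective open continuous homomorphism identifies [K] with an open subset
    of [G], so all conditions are inherited. *)
Lemma open_hom_ample : ample_groupoid G -> ample_groupoid K.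
Proof.
move=> aG; have ej : etale_map j.
  by split=> // x; exists setT => [|a b _ _ /j_inj//]; exact: filterT.
split.
- apply: etale_ample ej _ (ag_space aG).
  exact: continuous_injective_hausdorff j_cont j_inj (ag_space aG).1.
- move=> g V /j_open; rewrite hom_inv => /(ag_inv aG)/j_cont gV.
  apply: (@filterS _ (nbhs g) _ _ _ _ gV) => h [k Vk].
  by rewrite -hom_inv => /j_inj; rewrite /preimage /= => <-.
- move=> g h gh V /j_open; rewrite hom_mul // => /(ag_mul aG (hom_composable gh)).
  move=> [U [W [gU hW UWV]]]; exists (j @^-1` U), (j @^-1` W); split.
  + exact: j_cont.
  + exact: j_cont.
  + move=> g' h' Ug' Wh' gh'; have := UWV _ _ Ug' Wh' (hom_composable gh').
    by rewrite -hom_mul // => -[k Vk /j_inj <-].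
- move=> g V /j_open /(ag_open aG); rewrite -hom_rng => /j_cont gV.
  apply: (@filterS _ (nbhs (grng g)) _ _ _ _ gV) => h [_ [k Vk <-]].
  by rewrite -hom_rng => /j_inj kh; exists k.
- move=> g; have [U gU iU] := ag_inj aG (j g); exists (j @^-1` U); first exact: j_cont.
  by move=> a b Ua Ub ab; apply/j_inj/iU => //; rewrite -!hom_rng ab.
Qed.

Hypotheses (aK : ample_groupoid K) (aG : ample_groupoid G).
Variable A : zmodType.

Definition extension n : {additive Cc (nerve K n) A -> Cc (nerve G n) A} :=
  push A (nerve_ample aK n) (nerve_ample aG n).1 (etale_nerve_map n).

Lemma extensionE n (f : Cc (nerve K n) A) :
  (forall x, extension n f (nerve_map j x) = f x) /\
  (forall y, ~ range (@nerve_map K G j n) y -> extension n f y = 0).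
Proof. exact: (pushforward_injective f (@nerve_map_inj n)). Qed.

Lemma extension_boundary n (f : chain_complex aK A n.+1) :
  extension n (cdiff (chain_complex aK A) n f) =
  cdiff (chain_complex aG A) n (extension n.+1 f).
Proof.
rewrite [LHS]raddf_sum; apply: eq_bigr => i _; rewrite raddfMz; congr (_ *~ _).
apply: val_inj.
apply: etrans (pushforward_comp (nerve_ample aK n.+1) (nerve_ample aK n)
  (etale_face aK i) (etale_nerve_map n) (valP f)) _.
apply: etrans (esym (pushforward_comp (nerve_ample aK n.+1) (nerve_ample aG n.+1)
  (etale_nerve_map n.+1) (etale_face aG i) (valP f))).
by congr pushforward; apply/funext => x; rewrite /= face_nerve_map.
Qed.

Definition extension_map : chain_map (chain_complex aK A) (chain_complex aG A) :=
  @ChainMap (chain_complex aK A) (chain_complex aG A) extension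
    extension_boundary.

Lemma extension_inj n : injective (extension_map n).
Proof.
move=> f g fg; apply: val_inj; apply/funext => x.
have [fE _] := extensionE f; have [gE _] := extensionE g.
by rewrite -[LHS]fE -[RHS]gE; congr (_ _); exact: (congr1 val fg).
Qed.

Lemma extension_image n (f : Cc (nerve G n) A) :
  (exists g, extension_map n g = f) <->
  (forall y, ~ range (@nerve_map K G j n) y -> f y = 0).
Proof.
split; first by move=> [g <-]; exact: (extensionE g).2.
move=> f0; have [g gcc gf] := pushforward_open_image
  (nerve_map_continuous j_cont) (@nerve_map_open n) (@nerve_map_inj n) (valP f) f0.
by exists (MkCc gcc); apply: val_inj.
Qed.

(** A function that vanishes off an open subset is the extension by zero of its
    restriction, so a relative chain is a function on the complement of the
    nerve of the subgroupoid. *)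
Lemma quot_proj_extension n (f g : Cc (nerve G n) A) :
  quot_proj extension_map n f = quot_proj extension_map n g <->
  (forall y, ~ range (@nerve_map K G j n) y -> f y = g y).
Proof.
rewrite quot_proj_eq extension_image.
have E y : (f - g : Cc (nerve G n) A) y = f y - g y by [].
split=> fg y ny; last by rewrite E fg // subrr.
by apply/eqP; rewrite -subr_eq0 -E fg.
Qed.

End nerve_maps.

Section open_subgroupoids.
Variables (G : groupoid) (P : subgroupoid G).
Hypothesis oP : open (P : set G).

Lemma sub_incl_continuous : continuous (sub_incl P).
Proof. exact: set_val_continuous. Qed.

Lemma sub_incl_inj : injective (sub_incl P).
Proof. exact: set_val_inj. Qed.

Lemma range_sub_incl g : range (sub_incl P) g <-> (P : set G) g.
Proof.
split=> [[x _ <-]|Pg]; first exact: set_valP.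
by exists (exist _ g (mem_set Pg)) => //; rewrite /= set_valE.
Qed.

Lemma sub_incl_open : open_map (sub_incl P).
Proof.
move=> x V /open_sub_nbhs[W [oW Wx WV]]; have [O oO WO] := set_type_open oW.
apply: (@filterS _ _ _ (O `&` P)).
  move=> y [Oy Py]; exists (exist _ y (mem_set Py)); last by rewrite /= set_valE.
  by apply/WV/WO; rewrite set_valE.
apply: filterI; apply: open_nbhs_nbhs; split => //; first exact/WO.
exact: set_valP.
Qed.

Lemma etale_sub_nerve n : etale_map (nerve_map (sub_incl P) (n := n)).
Proof. exact: etale_nerve_map sub_incl_inj sub_incl_continuous sub_incl_open n. Qed.

Variable aG : ample_groupoid G.

Lemma sub_groupoid_ample : ample_groupoid (sub_groupoid P).
Proof. exact: open_hom_ample sub_incl_inj sub_incl_continuous sub_incl_open aG. Qed.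

Definition sub_extension (A : zmodType) :
    chain_map (chain_complex sub_groupoid_ample A) (chain_complex aG A) :=
  extension_map sub_incl_inj sub_incl_continuous sub_incl_open
    sub_groupoid_ample aG A.

Lemma sub_extension_by_zero A :
  extension_by_zero (sub_incl P) (sub_extension A).
Proof. by move=> n f; exact: extensionE. Qed.

Lemma sub_extension_exact A : long_exact_sequence (sub_extension A).
Proof. by apply: injective_long_exact_sequence => n; exact: extension_inj. Qed.

Lemma quot_proj_sub_extension A n (f g : Cc (nerve G n) A) :
  quot_proj (sub_extension A) n f = quot_proj (sub_extension A) n g <->
  (forall y, ~ range (nerve_map (sub_incl P) (n := n)) y -> f y = g y).
Proof. exact: quot_proj_extension. Qed.

End open_subgroupoids.

(** * The topology of the groupoid [H] *)

Section outside.
Variables (G : groupoid) (G' : subgroupoid G).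
Implicit Types g h d : G.

Lemma outside_mulr d g : outside G' d -> sub_arrows G' g -> composable G (d, g) ->
  outside G' (gmul d g).
Proof.
move=> Dd G'g dg G'dg; apply: Dd.
have -> : d = gmul (gmul d g) (ginv g).
  rewrite -gassoc //; last exact: composable_inv_r.
  by rewrite -[gmul g _]/(grng g) -[grng g]dg; exact: esym (gmul_src (gP G) d).
apply: sub_mul => //; first exact: sub_inv.
by rewrite /composable /= [LHS](gsrcM dg) grng_inv.
Qed.

Lemma outside_mull d g : outside G' d -> sub_arrows G' g -> composable G (g, d) ->
  outside G' (gmul g d).
Proof.
move=> Dd G'g gd G'gd; apply: Dd.
rewrite -(gmulVK gd); apply: sub_mul => //; first exact: sub_inv.
by apply: composable_invl; apply/esym/(grngM gd).
Qed.

(** Take [d] in [Delta] with [r d = r g]. If [g] lies in [G'] then [g^-1 d] lies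
    in [Delta], as [d] does, and its range is the source of [g]. *)
Lemma base_src g : base G' (grng g) -> base G' (gsrc g).
Proof.
move=> [d Dd dg]; have [G'g|Dg] := pselect (sub_arrows G' g); last first.
  by exists (ginv g); [exact: outside_inv|exact: grng_inv].
have gd : composable G (ginv g, d) by apply: composable_invl; rewrite dg.
exists (gmul (ginv g) d); last by rewrite [LHS](grngM gd) grng_inv.
by apply: outside_mull => //; exact: sub_inv.
Qed.

(** The set [r(Delta)] is invariant, so [H] is the preimage of [r(Delta)] under
    the range map alone. *)
Lemma reductionP g : reduction G' g <-> base G' (grng g).
Proof. by split=> [[]//|bg]; split => //; exact: base_src. Qed.

Lemma base_composable g h : composable G (g, h) ->
  base G' (grng g) <-> base G' (grng h).
Proof.
move=> gh; rewrite -[grng h]gh; split; first exact: base_src.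
by have := @base_src (ginv g); rewrite grng_inv gsrc_inv.
Qed.

End outside.

Section excision_topology.
Variables (G : groupoid) (aG : ample_groupoid G) (G' : subgroupoid G).
Hypotheses (openG' : open (G' : set G)) (regG' : regular_inclusion G').

Local Notation H := (exc_groupoid G').
Local Notation D := (outside G').
Local Notation v := (@exc_val G G').
Implicit Types (g h d : G).

(** A trace of the quotient topology of [r : Delta -> r(Delta)]: by regularity
    the sets [r (O `&` Delta)], with [O] a neighbourhood of [d] in [G], are a base
    of neighbourhoods of [r d], for any [d] in [Delta]. Arrows [x] stand here for
    their ranges. *)
Definition base_near (O : set G) (x : G) : Prop :=
  exists2 d, O d /\ D d & grng d = grng x.

Lemma base_nearS (O O' : set G) x :
  O `<=` O' -> base_near O x -> base_near O' x.
Proof. by move=> OO' [d [/OO' Od Dd] dx]; exists d. Qed.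

Lemma base_near_open (O : set G) : open O ->
  open [set x : set_type D | base_near O (set_val x)].
Proof.
move=> oO; have oDO : open (set_val @^-1` O : set (set_type D)) by exists O.
have := regG' oDO; congr open; apply/seteqP; split => [x [y Oy yx]|x [d [Od Dd] dx]].
  by exists (set_val y) => //; split => //; exact: set_valP.
exists (exist _ d (mem_set Dd)); first by rewrite /preimage /= set_valE.
by rewrite set_valE.
Qed.

(** The neighbourhoods of a point of [r(Delta)] do not depend on the element of
    [Delta] that represents it: this is regularity. *)
Lemma base_near_nbhs (O : set G) d d' : nbhs d O -> D d -> D d' ->
  grng d = grng d' ->
  exists2 O', nbhs d' O' & forall x, base_near O' x -> base_near O x.
Proof.
move=> /open_sub_nbhs[W [oW Wd WO]] Dd Dd' dd'.
have [O' oO' O'W] := set_type_open (base_near_open oW).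
have O'd : O' d'.
  have [+ _] := O'W (exist _ d' (mem_set Dd')).
  by rewrite /= set_valE /=; apply; exists d.
exists O'; first exact: open_nbhs_nbhs.
move=> x [e [O'e De] ex]; have [_ +] := O'W (exist _ e (mem_set De)).
rewrite /= set_valE /= => /(_ O'e)/(base_nearS WO)[f Of fe]; exists f => //.
by rewrite fe.
Qed.

Definition exc_nbhd (U O : set G) : set H := [set x | U (v x) /\ base_near O (v x)].

Lemma outside_in_reduction d : D d -> exists x : H, v x = d.
Proof. by move=> /outside_reduction /exc_val_surj[x _ xd]; exists x. Qed.

(** On [Delta] this is regularity. On pairs [(a, b)] with product in [G'] the
    second condition only concerns [r a = r (a b)] with [a] in [Delta], where
    regularity applies again. *)
Lemma exc_nbhd_open (U O : set G) : open U -> open O -> open (exc_nbhd U O).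
Proof.
move=> oU oO.
have imE x : (v @` exc_nbhd U O) x <-> U x /\ base_near O x.
  split; first by move=> [y [Uy Oy] <-].
  move=> [Ux Ox]; have [|y _ yx] := @exc_val_surj G G' x; last first.
    by exists y => //; split; rewrite yx.
  by apply/reductionP; have [d [_ Dd] <-] := Ox; exists d.
have oS := base_near_open oO; split.
  have : open ((set_val @^-1` U : set (set_type D)) `&`
      [set x | base_near O (set_val x)]) by apply: openI => //; exists U.
  by congr open; apply/seteqP; split => x; [move=> ?; exact/imE|move=> /imE].
have c1 (p : set_type (outside_pairs G')) V :
    nbhs (set_val p).1 V ->
    nbhs p [set q : set_type (outside_pairs G') | V (set_val q).1].
  move=> pV; apply: (@set_val_continuous _ (outside_pairs G') p [set q | V q.1]).
  by exists (V, setT) => [|[y z] []]; first by split => //=; exact: filterT.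
have c2 (p : set_type (outside_pairs G')) V :
    nbhs (set_val p).2 V ->
    nbhs p [set q : set_type (outside_pairs G') | V (set_val q).2].
  move=> pV; apply: (@set_val_continuous _ (outside_pairs G') p [set q | V q.2]).
  by exists (setT, V) => [|[y z] []]; first by split => //=; exact: filterT.
have cmul : continuous (@pairs_mul G G').
  move=> p; apply: (@gmul_cvg G aG _ (nbhs p)
    (fun q : set_type (outside_pairs G') => (set_val q).1)
    (fun q => (set_val q).2) _ _ (nbhs_filter p)).
  - exact: c1.
  - exact: c2.
  - by case: (set_valP p).
  - by move=> q; case: (set_valP q).
rewrite openE => p pUO; have [Up Op] := (imE _).1 pUO.
have D1 (q : set_type (outside_pairs G')) : D (set_val q).1.
  by case: (set_valP q).
have r1 (q : set_type (outside_pairs G')) : grng (pairs_mul q) = grng (set_val q).1.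
  by apply: grngM; case: (set_valP q).
have [O' oO' O'S] := set_type_open oS.
have SO' (q : set_type (outside_pairs G')) :
    base_near O (pairs_mul q) <-> O' (set_val q).1.
  have := O'S (exist _ (set_val q).1 (mem_set (D1 q))).
  rewrite /= set_valE /= => O'q.
  by split=> [[d Od dq]|/O'q[d Od dq]]; [apply/O'q|]; exists d; rewrite // dq r1.
have n1 : nbhs p [set q | U (@pairs_mul G G' q)].
  by apply: cmul; exact: open_nbhs_nbhs.
have n2 : nbhs p [set q : set_type (outside_pairs G') | O' (set_val q).1].
  by apply: c1; apply: open_nbhs_nbhs; split => //; exact/SO'.
apply: filterS (filterI n1 n2) => q [Uq /SO' Oq].
exact/imE.
Qed.

(** The sets [exc_nbhd U O] generate the topology of [H]: it is the coarsest one
    for which the inclusion in [G] and the map [r] to [r(Delta)], with its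
    quotient topology, are continuous. Near an arrow [x] of [G'] one writes
    [y = e (e^-1 y)] with [e] in [Delta] close to [d]; near an arrow of [Delta]
    one uses that [r] is injective close to [x]. *)
Lemma exc_basis (x : H) d (V : set H) : D d -> grng d = grng (v x) ->
  nbhs x V -> exists U O, [/\ nbhs (v x) U, nbhs d O & exc_nbhd U O `<=` V].
Proof.
move=> Dd dx /open_sub_nbhs[W [[oW1 oW2] Wx WV]].
have [G'x|Dx] := pselect (sub_arrows G' (v x)).
  have dx' : composable G (ginv d, v x) by exact: composable_invl.
  have pairP e y : D e -> sub_arrows G' y -> grng e = grng y ->
      outside_pairs G' (e, gmul (ginv e) y).
    move=> De G'y ey; have ey' := composable_invl ey; split => //=.
    - by apply: outside_mulr => //; exact: outside_inv.
    - by rewrite /composable /= [RHS](grngM ey') grng_inv.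
    - by rewrite gmulKV.
  have [O2 oO2 O2W] := set_type_open oW2.
  have pW e y (De : D e) (G'y : sub_arrows G' y) (ey : grng e = grng y) :
      O2 (e, gmul (ginv e) y) <-> (v @` W) y.
    have := O2W (exist _ (e, gmul (ginv e) y) (mem_set (pairP e y De G'y ey))).
    by rewrite /preimage /pairs_mul /= set_valE /= gmulKV // => eW; split=> /eW.
  have := open_nbhs_nbhs (conj oO2 ((pW d _ Dd G'x dx).2 (imageP v Wx))).
  move=> [[B1 B2] /= [dB1 xB2] BO2].
  have [U1 [U2 [dU1 xU2 UB2]]] := ag_mul aG dx' xB2.
  exists (U2 `&` (G' : set G)), (B1 `&` @ginv G @^-1` U1); split.
  - by apply: filterI => //; exact: open_nbhs_nbhs.
  - by apply: filterI => //; exact: (ag_inv aG).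
  move=> y [[U2y G'y] [e [[B1e U1e] De] ey]]; apply: WV.
  have [z Wz] : (v @` W) (v y).
    apply/(pW e) => //; apply: BO2; split => //=; apply: UB2 => //.
    exact: composable_invl.
  by move=> /exc_val_inj <-.
have [O1 oO1 O1W] := set_type_open oW1.
have [B xB iB] := ag_inj aG (v x).
have [|O dO OB] := @base_near_nbhs (O1 `&` B) (v x) d _ Dx Dd (esym dx).
  apply: filterI => //; apply: open_nbhs_nbhs; split => //.
  have [+ _] := O1W (exist _ (v x) (mem_set Dx)).
  by rewrite /preimage /= set_valE /=; apply; exact: imageP.
exists B, O; split => // y [By /OB[e [[O1e Be] De] ey]]; apply: WV.
have yE : v y = e by apply: iB.
have [_ +] := O1W (exist _ e (mem_set De)); rewrite /preimage /= set_valE /=.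
by move=> /(_ O1e)[z Wz]; rewrite -yE => /exc_val_inj <-.
Qed.

Lemma exc_base (x : H) : exists2 d, D d & grng d = grng (v x).
Proof.
have /reductionP[d Dd dx] : reduction G' (v x) by exact: set_valP.
by exists d.
Qed.

(** Convergence in [H] is convergence in [G] together with convergence of the
    ranges in [r(Delta)]. *)
Lemma exc_cvg (T : Type) (F : set_system T) (f : T -> H) (x : H) d : Filter F ->
  D d -> grng d = grng (v x) -> (fun t => v (f t)) @ F --> v x ->
  (forall O, nbhs d O -> F [set t | base_near O (v (f t))]) -> f @ F --> x.
Proof.
move=> FF Dd dx fx fd V /(exc_basis Dd dx)[U [O [xU dO UOV]]].
by apply: (@filterS _ F _ _ _ _ (filterI (fx _ xU) (fd _ dO))) => t ?; exact: UOV.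
Qed.

Lemma exc_val_continuous : continuous v.
Proof.
move=> x V /open_sub_nbhs[W [oW Wx WV]]; have [d Dd dx] := exc_base x.
have oN := exc_nbhd_open oW openT.
apply: (@filterS _ (nbhs x) _ _ _ _ (open_nbhs_nbhs (conj oN _))).
  by move=> y [Wy _]; exact: WV.
by split => //; exists d.
Qed.

Lemma exc_base_near (x : H) d (O : set G) : D d -> grng d = grng (v x) ->
  nbhs d O -> nbhs x [set y | base_near O (v y)].
Proof.
move=> Dd dx /open_sub_nbhs[W [oW Wd WO]].
have oN := exc_nbhd_open openT oW.
apply: (@filterS _ (nbhs x) _ _ _ _ (open_nbhs_nbhs (conj oN _))).
  by move=> y [_ ]; exact: base_nearS.
by split => //; exists d.
Qed.

Lemma exc_sub_open : open (exc_sub G' : set H).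
Proof.
have := exc_val_continuous; rewrite continuousP; apply; exact: openG'.
Qed.

Lemma exc_outside_open : open (v @^-1` D).
Proof.
have vD : v @` (v @^-1` D) = D.
  apply/seteqP; split=> [_ [x Dx <-]//|d Dd].
  by have [x xd] := outside_in_reduction Dd; exists x => //; rewrite /preimage /= xd.
split; rewrite vD.
  rewrite (_ : _ @^-1` _ = setT); first exact: openT.
  by apply/seteqP; split => // x _; exact: set_valP.
rewrite (_ : _ @^-1` _ = set0); first exact: open0.
by apply/seteqP; split => // p Dp; case: (set_valP p) => _ _ _; exact: Dp.
Qed.

Lemma exc_val_rng (x : H) : v (grng x) = grng (v x).
Proof. exact: (hom_rng (exc_incl G')). Qed.

Lemma exc_val_mul (x y : H) : composable H (x, y) ->
  v (gmul x y) = gmul (v x) (v y).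
Proof. exact: (hom_mul (exc_incl G')). Qed.

Lemma exc_val_composable (x y : H) : composable H (x, y) ->
  composable G (v x, v y).
Proof. exact: (hom_composable (exc_incl G')). Qed.

Lemma base_near_rng (O : set G) x y :
  grng x = grng y -> base_near O x -> base_near O y.
Proof. by move=> xy [d Od dx]; exists d => //; rewrite dx. Qed.

(** Convergence of the sources in [r(Delta)] has to be witnessed by arrows of
    [Delta]: these are [y^-1] if [x] is in [Delta], which is open in [H], and
    [y^-1 e], with [e] a witness for the ranges, if [x] is in [G']. *)
Lemma exc_inv_continuous : continuous (@ginv H).
Proof.
move=> x; have cvi : continuous (fun y : H => v (ginv y)).
  by apply: (ginv_continuous aG); exact: exc_val_continuous.
have [G'x|Dx] := pselect (sub_arrows G' (v x)); last first.
  apply: (@exc_cvg _ (nbhs x) _ _ (ginv (v x)) (nbhs_filter x)) => //.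
  - exact: outside_inv.
  - exact: cvi.
  move=> O xO; have Dn : nbhs x (v @^-1` D).
    by apply: open_nbhs_nbhs; split; [exact: exc_outside_open|].
  apply: (@filterS _ (nbhs x) _ _ _ _ (filterI Dn (cvi _ _ xO))).
  by move=> y [Dy Oy]; exists (ginv (v y)) => //; split => //; exact: outside_inv.
have [d Dd dx] := exc_base x; have dx' := composable_invl (esym dx).
apply: (@exc_cvg _ (nbhs x) _ _ (gmul (ginv (v x)) d) (nbhs_filter x)).
- by apply: outside_mull => //; exact: sub_inv.
- by rewrite [LHS](grngM dx').
- exact: cvi.
move=> O xO; have [U1 [U2 [xU1 dU2 UO]]] := ag_mul aG dx' xO.
have G'n : nbhs x (v @^-1` (G' : set G)).
  by apply: exc_val_continuous; exact: open_nbhs_nbhs.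
have n1 : nbhs x [set y | U1 (ginv (v y))] := cvi _ _ xU1.
have n2 := exc_base_near Dd dx dU2.
apply: (@filterS _ (nbhs x) _ _ _ _ (filterI G'n (filterI n1 n2))).
move=> y [G'y [U1y [e [U2e De] ey]]]; have ey' := composable_invl (esym ey).
exists (gmul (ginv (v y)) e); last exact: (grngM ey').
by split; [exact: UO|apply: outside_mull => //; exact: sub_inv].
Qed.

Lemma ultra_fmap (S T : Type) (f : S -> T) (F : set_system S) :
  UltraFilter F -> UltraFilter (f @ F).
Proof.
move=> UF; split=> [|Q PQ FQ]; first exact: fmap_proper_filter.
apply/seteqP; split=> // B QB.
have [//|nB] := in_ultra_setVsetC (f @^-1` B) UF.
by have [y []] := filter_ex (filterI QB (FQ (~` B) nB)).
Qed.

(** A pair of compact open sets [U] in [G] and [O] around a point of [Delta]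
    cuts out a compact open set of [H]: for an ultrafilter on it the arrows
    converge in [U], and witnesses in [Delta] with the same ranges converge in
    [O]. *)
Lemma exc_nbhd_compact (U O : set G) :
  compact U -> compact O -> compact (exc_nbhd U O).
Proof.
rewrite !compact_ultra => cU cO F UF FN.
have hG := (ag_space aG).1.
have /choice[c cP] : forall y : H, exists d,
    [/\ D d, grng d = grng (v y) & base_near O (v y) -> O d].
  move=> y; have [[d [Od Dd] dy]|nO] := pselect (base_near O (v y)).
    by exists d.
  by have [d Dd dy] := exc_base y; exists d.
have [|u [Uu vu]] := cU _ (ultra_fmap v UF).
  by apply: (@filterS _ F _ _ _ _ FN) => y [].
have [|d [Od cd]] := cO _ (ultra_fmap c UF).
  apply: (@filterS _ F _ _ _ _ FN) => y [_ Oy].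
  by have [_ _] := cP y; apply.
have Dd : D d.
  move=> G'd; have : (c @ F) (G' : set G) by apply: cd; exact: open_nbhs_nbhs.
  move=> G'c; have [y G'y] := @filter_ex _ F _ (c @^-1` (G' : set G)) G'c.
  by have [Dc _ _] := cP y; exact: Dc.
have ud : grng d = grng u.
  have cvE : (fun y : H => grng (v y)) = (fun y => grng (c y)).
    by apply/funext => y; case: (cP y).
  have rv : (fun y : H => grng (v y)) @ F --> grng u.
    exact: (grng_cvg aG _ vu).
  have rc : (fun y : H => grng (v y)) @ F --> grng d.
    by rewrite cvE; exact: (grng_cvg aG _ cd).
  have PF : ProperFilter F := @ultra_proper _ _ UF.
  exact: (@cvg_unique _ hG _ (fmap_proper_filter _ PF) _ _ rc rv).
have [|x _ xu] := @exc_val_surj G G' u.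
  by apply/reductionP; rewrite -ud; exists d.
exists x; split; first by split; rewrite xu //; exists d.
apply: (@exc_cvg _ F id x d _ Dd) => //; first by rewrite xu.
  by rewrite xu.
move=> W dW; apply: (@filterS _ F _ _ _ _ (cd _ dW)) => y Wy.
by have [Dc cy _] := cP y; exists (c y).
Qed.

Lemma exc_ample : ample_groupoid H.
Proof.
split.
- have hH : hausdorff_space (exc_arrows G').
    apply: (continuous_injective_hausdorff exc_val_continuous).
      exact: exc_val_inj.
    exact: (ag_space aG).1.
  split => // x V xV; have [d Dd dx] := exc_base x.
  have [U [O [xU dO UOV]]] := exc_basis Dd dx xV.
  have [U' [cU' oU' U'x UU']] := (ag_space aG).2 _ _ xU.
  have [O' [cO' oO' O'd OO']] := (ag_space aG).2 _ _ dO.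
  exists (exc_nbhd U' O'); split.
  + exact: exc_nbhd_compact.
  + exact: exc_nbhd_open.
  + by split => //; exists d.
  + by move=> y [/UU' Uy /(base_nearS OO') Oy]; exact: UOV.
- exact: exc_inv_continuous.
- move=> x y xy V xyV; have [d Dd dx] := exc_base x.
  have xy' := exc_val_composable xy.
  have [|U [O [xyU dO UOV]]] := exc_basis Dd _ xyV.
    by rewrite exc_val_mul // [RHS](grngM xy').
  rewrite exc_val_mul // in xyU.
  have [U1 [U2 [xU1 yU2 UU]]] := ag_mul aG xy' xyU.
  exists (v @^-1` U1 `&` [set z | base_near O (v z)]), (v @^-1` U2); split.
  + apply: filterI; first exact: exc_val_continuous.
    exact: exc_base_near dO.
  + exact: exc_val_continuous.
  + move=> x' y' [U1x' Ox'] U2y' xy1; apply: UOV.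
    have xy1' := exc_val_composable xy1; split; rewrite exc_val_mul //.
      exact: UU.
    by apply: base_near_rng Ox'; exact: esym (grngM xy1').
- move=> x V xV; have [d Dd dx] := exc_base x.
  have [U [O [xU dO UOV]]] := exc_basis Dd dx xV.
  have n1 : nbhs (grng x) (v @^-1` (@grng G @` U)).
    by apply: exc_val_continuous; rewrite exc_val_rng; exact: (ag_open aG).
  have n2 : nbhs (grng x) [set z | base_near O (v z)].
    by apply: (exc_base_near Dd) => //; rewrite exc_val_rng grng_rng.
  apply: (@filterS _ (nbhs (grng x)) _ _ _ _ (filterI n1 n2)).
  move=> z [[u Uu uz] Oz]; have Ou : base_near O u.
    by apply: base_near_rng Oz; rewrite -uz grng_rng.
  have [|y _ yu] := @exc_val_surj G G' u.
    by apply/reductionP; have [e [_ De] <-] := Ou; exists e.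
  exists y; first by apply: UOV; split; rewrite yu.
  by apply: (@exc_val_inj G G'); rewrite exc_val_rng yu.
- move=> x; have [U xU iU] := ag_inj aG (v x).
  exists (v @^-1` U); first exact: exc_val_continuous.
  by move=> a b Ua Ub ab; apply/(@exc_val_inj G G')/iU => //; rewrite -!exc_val_rng ab.
Qed.

(** A criterion that no longer mentions [Delta], used to pass from one entry of a
    tuple to the next. *)
Lemma exc_cvg_rng (T : Type) (F : set_system T) (f : T -> H) (x : H) : Filter F ->
  (fun t => v (f t)) @ F --> v x -> (fun t => grng (f t)) @ F --> grng x ->
  f @ F --> x.
Proof.
move=> FF vf rf; have [d Dd dx] := exc_base x.
apply: (@exc_cvg _ F f x d _ Dd dx vf) => O dO.
have n2 : nbhs (grng x) [set z | base_near O (v z)].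
  by apply: (exc_base_near Dd) => //; rewrite exc_val_rng grng_rng.
apply: (@filterS _ F _ _ _ _ (rf _ n2)) => t; rewrite /preimage /=.
by apply: base_near_rng; rewrite exc_val_rng grng_rng.
Qed.

End excision_topology.

(** * Chains off the subgroupoids *)

Section excision_chains.
Variables (G : groupoid) (aG : ample_groupoid G) (G' : subgroupoid G).
Hypotheses (openG' : open (G' : set G)) (regG' : regular_inclusion G')
  (unitsG' : G' `&` units G = units G).

Local Notation H := (exc_groupoid G').
Local Notation D := (outside G').
Local Notation toG := (exc_incl G').
Local Notation incG := (sub_incl G').
Local Notation incH := (sub_incl (exc_sub G')).

Let aH : ample_groupoid H := exc_ample aG openG' regG'.
Let openH' : open (exc_sub G' : set H) := exc_sub_open aG openG' regG'.

Definition off_G n (y : nerve G n) : Prop := ~ range (nerve_map incG (n := n)) y.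
Definition off_H n (x : nerve H n) : Prop := ~ range (nerve_map incH (n := n)) x.

Lemma toG_inj : injective toG.
Proof. exact: (@exc_val_inj G G'). Qed.

Lemma toG_continuous : continuous toG.
Proof. exact: exc_val_continuous. Qed.

Lemma off_GP n (y : nerve G n) :
  off_G y <-> exists2 k, (k <= n.-1)%N & D (entry y k).
Proof.
rewrite /off_G range_nerve_map; last exact: sub_incl_inj.
split=> [ny|[k kn Dk] yG']; last first.
  by apply: Dk; have /range_sub_incl := yG' k kn.
apply: contrapT => nk; apply: ny => k kn; apply/range_sub_incl.
by apply: contrapT => Dk; apply: nk; exists k.
Qed.

Lemma off_HP n (x : nerve H n) : off_H x <-> off_G (nerve_map toG x).
Proof.
rewrite off_GP /off_H range_nerve_map; last exact: sub_incl_inj.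
split=> [nx|[k kn Dk] xH']; last first.
  by rewrite entry_nerve_map in Dk; apply: Dk; have /range_sub_incl := xH' k kn.
apply: contrapT => nk; apply: nx => k kn; apply/range_sub_incl.
by apply: contrapT => Dk; apply: nk; exists k => //; rewrite entry_nerve_map.
Qed.

(** As [r(Delta)] is invariant, a tuple with one arrow in [H] is a tuple of
    arrows of [H]. *)
Lemma range_toG n (y : nerve G n) : range (nerve_map toG (n := n)) y <->
  exists2 k, (k <= n.-1)%N & base G' (grng (entry y k)).
Proof.
rewrite range_nerve_map; last exact: toG_inj.
split=> [/(_ 0 isT)[g _ gy]|[k kn bk] l ln].
  by exists 0%N => //; rewrite -gy; apply/reductionP; exact: set_valP.
apply/exc_val_surj/reductionP.
have b0 : forall m, (m <= n.-1)%N ->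
    base G' (grng (entry y m)) <-> base G' (grng (entry y 0)).
  elim=> // m IHm mn; rewrite -IHm; last exact: ltnW.
  case: n y mn {kn bk ln IHm} => // n y mn.
  by rewrite -(base_composable G' (entry_composable y mn)).
by apply/b0 => //; apply/(b0 k).
Qed.

Lemma off_image n :
  nerve_map toG (n := n) @` (~` range (nerve_map incH (n := n))) =
  ~` range (nerve_map incG (n := n)).
Proof.
apply/seteqP; split => [_ [x nx <-]|y ny]; first exact/off_HP.
have [|x _ xy] := (range_toG y).2.
  have /off_GP[k kn Dk] : off_G y by [].
  by exists k => //; exists (entry y k).
by exists x => //; apply/off_HP; rewrite xy.
Qed.

(** Units belong to [G'], so in degree 0 there is nothing off [G']. *)
Lemma entry0_inside (y : nerve G 0) : ~ off_G y.
Proof.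
move=> /off_GP[k _]; apply; rewrite -entry_unit.
have : units G (grng (entry y k)) by exact: grng_unit.
by rewrite -unitsG' => -[].
Qed.

(** Off the subgroupoids the nerves of [H] and [G] carry the same topology.
    The tuples along [F] are sorted by an entry [k] that lies in [Delta]. If the
    limit has its [k]-th entry in the open set [G'], such tuples are eventually
    absent. Otherwise the [k]-th entries converge in [Delta], whose topology [H]
    and [G] share, and convergence in [H] spreads to the neighbouring entries,
    because an arrow of [H] converges as soon as it converges in [G] and one of
    its end points converges in [H]. *)
Lemma off_cvg n (F : set_system (nerve H n)) (x : nerve H n) : Filter F ->
  off_H x -> F [set y : nerve H n | off_H y] ->
  nerve_map toG (n := n) @ F --> nerve_map toG x ->
  F --> x.
Proof.
move=> FF xoff Foff Fx.
case: n F x FF xoff Foff Fx => [|m] F x FF xoff Foff Fx.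
  by case: (@entry0_inside (nerve_map toG x)); exact/off_HP.
have vF k : (fun y : nerve H m.+1 => toG (entry y k)) @ F --> toG (entry x k).
  move=> V; rewrite -entry_nerve_map => /(@entry_continuous G m.+1 k)/Fx.
  apply: (@filterS _ F) => y Vy; change (V (toG (entry y k))).
  by rewrite -entry_nerve_map; exact: Vy.
move=> V xV; pose S (k : 'I_m.+1) := [set y : nerve H m.+1 | D (toG (entry y k))].
suff SV (k : 'I_m.+1) : F [set y | S k y -> V y].
  have {}SV : F [set y | forall k, S k y -> V y] by exact: filter_forall.
  apply: (@filterS _ F _ _ _ _ (filterI SV Foff)) => y [yV].
  move=> /off_HP/off_GP[k kn]; rewrite entry_nerve_map => Dk.
  exact: (yV (Ordinal (kn : (k < m.+1)%N))).
have [G'k|Dk] := pselect (sub_arrows G' (toG (entry x k))).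
  have : F [set y | sub_arrows G' (toG (entry y k))].
    by apply: vF; exact: open_nbhs_nbhs.
  by apply: (@filterS _ F) => y G'y; rewrite /S /= => /(_ G'y).
suff : within (S k) F --> x by apply.
have vF' l :
    (fun y : nerve H m.+1 => toG (entry y l)) @ within (S k) F --> toG (entry x l).
  by move=> W /(vF l) FW; apply: (@filterS _ F _ _ _ _ FW) => y Wy _.
have Pk : (fun y : nerve H m.+1 => entry y k) @ within (S k) F --> entry x k.
  apply: (@exc_cvg _ aG G' openG' regG' _ (within (S k) F) _ _ (toG (entry x k))) => //.
    exact: vF'.
  move=> O /(vF' k) FO.
  change (F [set y | S k y -> base_near G' O (toG (entry y k))]).
  apply: (@filterS _ F _ [set y | S k y -> O (toG (entry y k))] _ _ FO).
  move=> y yO Sy; have Oy := yO Sy.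
  by exists (toG (entry y k)).
have up l : (l < m)%N ->
    (fun y : nerve H m.+1 => entry y l) @ within (S k) F --> entry x l ->
    (fun y : nerve H m.+1 => entry y l.+1) @ within (S k) F --> entry x l.+1.
  move=> lm /(gsrc_cvg aH _) ls; apply: exc_cvg_rng => //; first exact: vF'.
  have E (z : nerve H m.+1) : grng (entry z l.+1) = gsrc (entry z l).
    by apply/esym; exact: (entry_composable z lm).
  by rewrite E; under eq_fun do rewrite E.
have down l : (l < m)%N ->
    (fun y : nerve H m.+1 => entry y l.+1) @ within (S k) F --> entry x l.+1 ->
    (fun y : nerve H m.+1 => entry y l) @ within (S k) F --> entry x l.
  move=> lm /(grng_cvg aH _) lr.
  have E (z : nerve H m.+1) : grng (ginv (entry z l)) = grng (entry z l.+1).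
    by rewrite grng_inv; exact: (entry_composable z lm).
  rewrite -[entry x l]ginvK; under eq_fun do rewrite -[entry _ l]ginvK.
  apply: (ginv_cvg aH); apply: exc_cvg_rng => //; last first.
    by rewrite E; under eq_fun do rewrite E.
  exact: (ginv_cvg aG _ (vF' l)).
have P l : (l <= m)%N ->
    (fun y : nerve H m.+1 => entry y l) @ within (S k) F --> entry x l.
  have [kl|/ltnW lk _] := leqP k l.
    rewrite -(subnKC kl); elim: (l - k)%N => [|i IHi]; first by rewrite addn0.
    by rewrite addnS => lm; apply: up => //; apply: IHi; exact: ltnW.
  rewrite -(subKn lk); elim: (k - l)%N (leq_subr l k) => [|i IHi] ik.
    by rewrite subn0.
  have km := ltn_ord k; apply: down; first by lia.
  by rewrite subnSK; [apply: IHi; lia|lia].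
by apply: (@nerve_cvg _ _ _ (within (S k) F) id) => l /P.
Qed.

Lemma off_nbhs n (x : nerve H n) (V : set (nerve H n)) : off_H x -> nbhs x V ->
  exists2 W, nbhs (nerve_map toG x) W &
    forall y : nerve H n, off_H y -> W (nerve_map toG y) -> V y.
Proof.
move=> nx xV; pose F : set_system (nerve H n) := [set S | exists2 W,
  nbhs (nerve_map toG x) W &
  forall y : nerve H n, off_H y -> W (nerve_map toG y) -> S y].
have FF : Filter F.
  split.
  - by exists setT => //; exact: filterT.
  - move=> S T [W xW WS] [W' xW' WT]; exists (W `&` W'); first exact: filterI.
    by move=> y ny [Wy W'y]; split; [exact: WS|exact: WT].
  - by move=> S T ST [W xW WS]; exists W => // y ny /(WS y ny)/ST.
suff : F --> x by apply.
apply: off_cvg => //; first by exists setT => //; exact: filterT.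
by move=> W xW; exists W.
Qed.

Lemma off_G_closed n : closed [set y : nerve G n | off_G y].
Proof.
apply: open_closedC; have [_ op _] := etale_sub_nerve openG' n.
by apply: open_map_image op _; exact: openT.
Qed.

Lemma off_H_closed n : closed [set x : nerve H n | off_H x].
Proof.
apply: open_closedC; have [_ op _] := etale_sub_nerve openH' n.
by apply: open_map_image op _; exact: openT.
Qed.

(** * The isomorphism of quotient complexes *)

Section agreement.
Variable A : zmodType.

Definition agree n (f : nerve G n -> A) (h : nerve H n -> A) : Prop :=
  forall x, off_H x -> f (nerve_map toG x) = h x.

Lemma nerve_toG_continuous n : continuous (nerve_map toG (n := n)).
Proof. exact/nerve_map_continuous/toG_continuous. Qed.

(** The function [f] pulled back to the nerve of [H] need not have compact support,
    but its support off [G'] is compact there, and only the values at such tuples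
    have to be kept. *)
Lemma agree_to_H n (f : Cc (nerve G n) A) : exists h : Cc (nerve H n) A, agree f h.
Proof.
have [lf kf] := (compactly_supportedP f).1 (valP f).
have [||h hcc hf] := @Cc_extension (nerve H n) A [set x | off_H x]
    (f \o nerve_map toG (n := n)) (nerve_ample aH n).
- move=> x nx.
  exists [set y : nerve H n | f (nerve_map toG y) = f (nerve_map toG x)] => //.
  exact: nerve_toG_continuous (lf _).
- move=> F FF FK.
  have kZ : compact ([set y : nerve G n | f y != 0] `&` [set y | off_G y]).
    by apply: compact_closedI => //; exact: off_G_closed.
  have FZ : (nerve_map toG (n := n) @ F)
      ([set y : nerve G n | f y != 0] `&` [set y | off_G y]).
    by apply: (@filterS _ F _ _ _ _ FK) => x [/off_HP nx fx]; split.
  have [y [[fy ny] Fy]] := kZ _ (fmap_proper_filter _ FF) FZ.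
  have [x nx xy] : (nerve_map toG (n := n) @` [set x | off_H x]) y.
    by rewrite (off_image n).
  exists x; split; first by split => //; rewrite /= xy.
  move=> S V FS xV; have [W xW WV] := off_nbhs nx xV.
  rewrite xy in xW.
  have FS' : (nerve_map toG (n := n) @ F)
      (nerve_map toG (n := n) @` (S `&` [set x | off_H x])).
    by apply: (@filterS _ F _ _ _ _ (filterI FS FK)) => z [Sz [nz _]]; exists z.
  have [_ [[z [Sz nz] <-] Wz]] := Fy _ _ FS' xW.
  by exists z; split => //; exact: WV.
by exists (MkCc hcc) => x nx; rewrite /= hf.
Qed.

(** The values of [h] on tuples off [G'] are transported to the nerve of [G],
    where they stay locally constant because both nerves induce the same
    topology there, and then extended. *)
Lemma agree_to_G n (h : Cc (nerve H n) A) : exists f : Cc (nerve G n) A, agree f h.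
Proof.
have [lh kh] := (compactly_supportedP h).1 (valP h).
pose g (y : nerve G n) : A :=
  if pselect (exists x : nerve H n, nerve_map toG x = y) is left xy
  then h (projT1 (cid xy)) else 0.
have gE (x : nerve H n) : g (nerve_map toG x) = h x.
  rewrite /g; case: pselect => [xy|[]]; last by exists x.
  by congr (h _); apply: (nerve_map_inj toG_inj); exact: projT2 (cid xy).
have Zim (y : nerve G n) :
    off_G y -> exists2 x : nerve H n, off_H x & nerve_map toG x = y.
  move=> ny; have : (~` range (nerve_map incG (n := n))) y by [].
  by rewrite -off_image.
have [||f fcc fg] :=
  @Cc_extension (nerve G n) A [set y | off_G y] g (nerve_ample aG n).
- move=> _ /Zim[x nx <-]; have [W xW WV] := off_nbhs nx (lh x).
  exists W => // y Wy /Zim[z nz zE]; rewrite -zE in Wy *.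
  by rewrite !gE; exact: WV.
- rewrite (_ : _ `&` _ =
      nerve_map toG (n := n) @` ([set x | h x != 0] `&` [set x | off_H x])).
    apply: continuous_compact.
      by apply: continuous_subspaceT; exact: nerve_toG_continuous.
    by apply: compact_closedI => //; exact: off_H_closed.
  apply/seteqP; split=> [_ [/Zim[x nx <-] /= gx]|_ [x [hx nx] <-]].
    by exists x => //; split => //=; rewrite -gE.
  by split; [exact/off_HP|rewrite /= gE].
by exists (MkCc fcc) => x /off_HP nx; rewrite /= fg // gE.
Qed.

(** An arrow composable with arrows of [H] lies in [H], so a face map has the
    same fibres over the nerve of [H] in both nerves. *)
Lemma pushforward_toG n (i : 'I_n.+2) (f : nerve G n.+1 -> A) (x : nerve H n) :
  pushforward (face i) f (nerve_map toG x) =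
  pushforward (face i) (f \o nerve_map toG (n := n.+1)) x.
Proof.
rewrite /pushforward -[RHS](@fsbig_image _ _ _ _ _
    (face i @^-1` [set x]) (nerve_map toG (n := n.+1)) f).
  congr (\sum_(y \in _) f y); apply/seteqP; split=> [y yx|_ [y yx <-]]; last first.
    by rewrite /preimage /= (face_nerve_map toG) yx.
  have [|z _ zy] := (range_toG y).2.
    have /range_toG[k kn] : range (nerve_map toG (n := n)) (face i y).
      by rewrite yx; exists x.
    case: n i f x y yx kn => [|m] i f x y yx kn.
      rewrite entry_face0; case: ifP => _ bk; exists 0%N => //; last first.
        by rewrite grng_rng in bk.
      have := @base_src G G' (ginv (entry y 0)).
      by rewrite grng_inv gsrc_inv; apply; rewrite grng_src in bk.
    rewrite entry_face // /face_entry; case: ifP => _ => [bk|].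
      by exists k => //; exact: leqW.
    case: ifP => _ bk; last by exists k.+1.
    exists k; first exact: leqW.
    move: bk; rewrite [grng (gmul _ _)]grngM //.
    exact: entry_composable.
  exists z => //; apply: (nerve_map_inj toG_inj).
  by rewrite -(face_nerve_map toG) zy.
by move=> y z _ _; exact: nerve_map_inj toG_inj _ _ _.
Qed.

(** A tuple with a face off the subgroupoid is itself off the subgroupoid, so the
    boundary at such a face only involves values on which [f] and [h] agree. *)
Lemma agree_boundary n (f : Cc (nerve G n.+1) A) (h : Cc (nerve H n.+1) A) :
  agree f h -> agree (chain_boundary aG f) (chain_boundary aH h).
Proof.
move=> fh x nx; rewrite !chain_boundaryE; apply: eq_bigr => i _; congr (_ *~ _).
rewrite pushforward_toG; apply: eq_fsbigr => y; rewrite inE => yx.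
apply: fh => -[z _ zy]; apply: nx; exists (face i z) => //.
by rewrite -(face_nerve_map incH) zy.
Qed.

Lemma agreeB n (f f' : Cc (nerve G n) A) (h h' : Cc (nerve H n) A) :
  agree f h -> agree f' h' ->
  agree (f - f' : Cc (nerve G n) A) (h - h' : Cc (nerve H n) A).
Proof.
move=> fh fh' x nx.
change (f (nerve_map toG x) - f' (nerve_map toG x) = h x - h' x).
by rewrite fh // fh'.
Qed.

Let iG := sub_extension openG' aG A.
Let iH := sub_extension openH' aH A.

Lemma quot_G_eq n (f g : Cc (nerve G n) A) :
  quot_proj iG n f = quot_proj iG n g <-> (forall y, off_G y -> f y = g y).
Proof. exact: quot_proj_sub_extension. Qed.

Lemma quot_H_eq n (f g : Cc (nerve H n) A) :
  quot_proj iH n f = quot_proj iH n g <-> (forall x, off_H x -> f x = g x).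
Proof. exact: quot_proj_sub_extension. Qed.

(** The graph of the isomorphism of quotient complexes. *)
Definition corresponds n (u : quot_complex iG n) (w : quot_complex iH n) : Prop :=
  exists f h, [/\ quot_proj iG n f = u, quot_proj iH n h = w & agree f h].

Lemma corresponds_proj n (f : Cc (nerve G n) A) (h : Cc (nerve H n) A) :
  corresponds (quot_proj iG n f) (quot_proj iH n h) <-> agree f h.
Proof.
split=> [[f' [h' [/quot_G_eq ff' /quot_H_eq hh' fh']]] x nx|fh]; last by exists f, h.
by rewrite -hh' // -ff' ?fh' //; exact/off_HP.
Qed.

Lemma corresponds_total n (u : quot_complex iG n) : exists w, corresponds u w.
Proof.
have [f <-] := quot_proj_surj u; have [h fh] := agree_to_H f.
by exists (quot_proj iH n h), f, h.
Qed.

Lemma corresponds_surj n (w : quot_complex iH n) : exists u, corresponds u w.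
Proof.
have [h <-] := quot_proj_surj w; have [f fh] := agree_to_G h.
by exists (quot_proj iG n f), f, h.
Qed.

Lemma corresponds_fun n (u : quot_complex iG n) (w w' : quot_complex iH n) :
  corresponds u w -> corresponds u w' -> w = w'.
Proof.
have [h <-] := quot_proj_surj w; have [h' <-] := quot_proj_surj w'.
have [f <-] := quot_proj_surj u.
move=> /corresponds_proj fh /corresponds_proj fh'; apply/quot_H_eq => x nx.
by rewrite -fh // fh'.
Qed.

Lemma corresponds_inj n (u u' : quot_complex iG n) (w : quot_complex iH n) :
  corresponds u w -> corresponds u' w -> u = u'.
Proof.
have [f <-] := quot_proj_surj u; have [f' <-] := quot_proj_surj u'.
have [h <-] := quot_proj_surj w.
move=> /corresponds_proj fh /corresponds_proj fh'; apply/quot_G_eq => y ny.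
have : (~` range (nerve_map incG (n := n))) y by [].
by rewrite -off_image => -[x nx <-]; rewrite fh // fh'.
Qed.

Lemma correspondsB n (u u' : quot_complex iG n) (w w' : quot_complex iH n) :
  corresponds u w -> corresponds u' w' -> corresponds (u - u') (w - w').
Proof.
move=> [f [h [<- <- fh]]] [f' [h' [<- <- fh']]].
exists (f - f'), (h - h'); split; [exact: raddfB|exact: raddfB|exact: agreeB].
Qed.

Lemma corresponds_cdiff n (u : quot_complex iG n.+1) (w : quot_complex iH n.+1) :
  corresponds u w ->
  corresponds (cdiff (quot_complex iG) n u) (cdiff (quot_complex iH) n w).
Proof.
move=> [f [h [<- <- fh]]]; rewrite -!chain_funE.
exact/corresponds_proj/agree_boundary.
Qed.

Lemma quotient_complexes_isomorphic :
  exists Phi : chain_map (quot_complex iG) (quot_complex iH),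
    (forall n, bijective (Phi n)) /\
    (forall n (f : Cc (nerve G n) A) (h : Cc (nerve H n) A),
      Phi n (quot_proj iG n f) = quot_proj iH n h <-> agree f h).
Proof.
have phi n := additive_rel (@corresponds_total n) (@corresponds_fun n)
  (@correspondsB n).
have phiE n (u : quot_complex iG n.+1) :
    sval (phi n) (cdiff (quot_complex iG) n u) =
    cdiff (quot_complex iH) n (sval (phi n.+1) u).
  apply/esym/(svalP (phi n)); apply: corresponds_cdiff.
  exact/(svalP (phi n.+1)).
pose Phi := @ChainMap (quot_complex iG) (quot_complex iH)
  (fun n => sval (phi n)) phiE.
have PhiP n u w : corresponds u w <-> w = Phi n u := svalP (phi n) u w.
exists Phi; split=> n; last by move=> f h; rewrite -corresponds_proj PhiP; split=> ->.
rewrite -setTT_bijective; split => // [u u' _ _ uu'|w _].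
  apply: (@corresponds_inj n u u' (Phi n u)); first exact/PhiP.
  by rewrite uu'; exact/PhiP.
by have [u /PhiP uw] := corresponds_surj w; exists u.
Qed.

End agreement.

End excision_chains.

Theorem theorem3p11 (G : groupoid) (etG : etale_groupoid G)
  (tdG : totally_disconnected [set: G])
  (G' : subgroupoid G) (openG' : open (G' : set G))
  (unitsG' : G' `&` units G = units G)
  (regG' : regular_inclusion G') (A : zmodType) :
  let H := exc_groupoid G' in
  let H' := exc_sub G' in
  let incG := sub_incl G' in
  let incH := sub_incl H' in
  let toG := exc_incl G' in
  exists (CG' : groupoid_complex (sub_groupoid G') A)
         (CG : groupoid_complex G A)
         (CH' : groupoid_complex (sub_groupoid H') A)
         (CH : groupoid_complex H A)
         (iG : chain_map CG' CG) (iH : chain_map CH' CH),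
    [/\ extension_by_zero incG iG,
        extension_by_zero incH iH,
        long_exact_sequence iG,
        long_exact_sequence iH &
        (forall n, nerve_map toG (n := n) @` (~` range (nerve_map incH (n := n)))
                   = ~` range (nerve_map incG (n := n)))
        /\
        exists Phi : chain_map (quot_complex iG) (quot_complex iH),
          [/\ forall n, bijective (Phi n),
              forall n (f : Cc (nerve G n) A) (h : Cc (nerve H n) A),
                Phi n (quot_proj iG n f) = quot_proj iH n h <->
                (forall x : nerve H n, ~ range (nerve_map incH (n := n)) x ->
                   f (nerve_map toG x) = h x) &
              forall n, bijective (homology_map Phi n)]].
Proof.
have aG := etale_groupoid_ample etG tdG.
pose aH := exc_ample aG openG' regG'.
pose openH' := exc_sub_open aG openG' regG'.
have [Phi [bijPhi PhiE]] :=
  quotient_complexes_isomorphic aG openG' regG' unitsG' A.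
exists (chain_complex (sub_groupoid_ample openG' aG) A), (chain_complex aG A),
  (chain_complex (sub_groupoid_ample openH' aH) A), (chain_complex aH A),
  (sub_extension openG' aG A), (sub_extension openH' aH A).
split; [exact: sub_extension_by_zero|exact: sub_extension_by_zero
  |exact: sub_extension_exact|exact: sub_extension_exact|].
split; first exact: off_image.
by exists Phi; split => //; exact: bijective_homology_map.
Qed.
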